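(* Let $\mathcal{X}$ be a finite set, $P\in\mathcal{L}$ a transition matrix on $\mathcal{X}$, $\pi\in\mathcal{P}(\mathcal{X})$ strictly positive, $\alpha\in(0,1)\cup(1,+\infty)$, and $f:\mathbb{R}^+\to\mathbb{R}$ convex with $f(1)=0$. Then: (i) (Non-negativity and normalization) $0\le\eta^f(P)\le\eta^{(\mathrm{TV})}(P)\le1$, $0\le\eta^{(R_\alpha)}(P)\le1$ and $0\le\widetilde\eta^{(R_\alpha)}(P)\le1$. (ii) (Coefficients on the space $\mathcal{P}(\mathcal{X})$ versus on the space $\mathcal{L}$) $\eta^f(P)=\widetilde\eta^f(P)$ and $\eta^{(R_\alpha)}(P)\ge\widetilde\eta^{(R_\alpha)}(P)$. (iii) (Bounds) Suppose that the sequences of pairs $(U_n^*,V_n^* )$ in $\mathcal{L}\times\mathcal{L}$ and $(\mu_n^*,\nu_n^* )$ in $\mathcal{P}(\mathcal{X})\times\mathcal{P}(\mathcal{X})$ approach $\eta^{(R_\alpha)}(P)$ and $\widetilde\eta^{(R_\alpha)}(P)$ respectively, that is, $$\eta^{(R_\alpha)}(P)=\lim_{n\to\infty}\frac{R_\alpha(U_n^*P\|V_n^*P)}{R_\alpha(U_n^*\|V_n^* )},\qquad \widetilde\eta^{(R_\alpha)}(P)=\lim_{n\to\infty}\frac{\widetilde R_\alpha(\mu_n^*P\|\nu_n^*P)}{\widetilde R_\alpha(\mu_n^*\|\nu_n^* )},$$ and, by passing to a subsequence if necessary, assume that $(U_n^*,V_n^* )\to(U^*,V^* )$ and $(\mu_n^*,\nu_n^*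 )\to(\mu^*,\nu^* )$ pointwise. Then for $\alpha>1$, $$\eta^{(D_\alpha)}(P)\le\eta^{(R_\alpha)}(P)\le\begin{cases}\dfrac{\ln(1+(\alpha-1)\eta^{(D_\alpha)}(P)D_\alpha(U^*\|V^* ))}{\ln(1+(\alpha-1)D_\alpha(U^*\|V^* ))}\le1,&\text{if }U^*\ne V^*,\\ \eta^{(D_\alpha)}(P)\le1,&\text{if }U^*=V^*,\end{cases}$$ $$\widetilde\eta^{(D_\alpha)}(P)\le\widetilde\eta^{(R_\alpha)}(P)\le\begin{cases}\dfrac{\ln(1+(\alpha-1)\widetilde\eta^{(D_\alpha)}(P)\widetilde D_\alpha(\mu^*\|\nu^* ))}{\ln(1+(\alpha-1)\widetilde D_\alpha(\mu^*\|\nu^* ))}\le1,&\text{if }\mu^*\ne\nu^*,\\ \widetilde\eta^{(D_\alpha)}(P)\le1,&\text{if }\mu^*=\nu^*,\end{cases}$$ while for $\beta\in(0,1)$, $\eta^{(R_\beta)}(P)\le\eta^{(D_\beta)}(P)$ and $\widetilde\eta^{(R_\beta)}(P)\le\widetilde\eta^{(D_\beta)}(P)$. (iv) (Convexity) The mappings $\mathcal{L}\ni P\mapsto\eta^f(P)$ and $\mathcal{L}\ni P\mapsto\eta^{(R_\alpha)}(P)$ are convex if $\alpha\in(0,1)$. (v) (Submultiplicativity) For $P,Q\in\mathcal{L}$, $\eta^f(PQ)\le\eta^f(P)\eta^f(Q)$. (vi) (Symmetry) If $\alpha\in(0,1)$, then $\eta^{(R_\alpha)}(P)=\eta^{(R_{1-\alpha})}(P)$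 and $\eta^{(D_\alpha)}(P)=\eta^{(D_{1-\alpha})}(P)$. (vii) (Equivalence) For $0<\alpha<\beta<1$, $$\frac{\alpha}{\beta}\frac{1-\beta}{1-\alpha}\,\eta^{(R_\beta)}(P)\le\eta^{(R_\alpha)}(P)\le\frac{\beta}{\alpha}\frac{1-\alpha}{1-\beta}\,\eta^{(R_\beta)}(P).$$ (viii) (Scrambling) $P$ is scrambling if and only if any one (and hence all) of the ergodicity coefficients $\eta^f(P)$, $\eta^{(D_\alpha)}(P)$, $\eta^{(R_\beta)}(P)$, $\widetilde\eta^{(D_\alpha)}(P)$, $\widetilde\eta^{(R_\beta)}(P)$ is less than $1$, where $\beta>1$. (ix) (Unit rank and independence) Let $f$ be strictly convex at $1$. Then $P$ has unit rank if and only if any one (and hence all) of the ergodicity coefficients $\eta^f(P)$, $\eta^{(D_\alpha)}(P)$, $\eta^{(R_\beta)}(P)$, $\widetilde\eta^{(D_\alpha)}(P)$, $\widetilde\eta^{(R_\beta)}(P)$ equals $0$, where $\beta>1$.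
   Context: $\mathcal{P}(\mathcal{X})$ is the set of probability mass functions on the finite set $\mathcal{X}$, and $\mathcal{L}=\mathcal{L}(\mathcal{X})$ the set of transition (row-stochastic) matrices on $\mathcal{X}$. For $\mu,\nu\in\mathcal{P}(\mathcal{X})$: $\widetilde D_f(\mu\|\nu):=\sum_x\nu(x)f(\mu(x)/\nu(x))$, with conventions $0f(0/0)=0$ and $0f(a/0)=a\lim_{u\to0^+}uf(1/u)$ for $a>0$. For $M,L\in\mathcal{L}$: $D_f(M\|L):=\sum_x\pi(x)\sum_y L(x,y)f\left(\frac{M(x,y)}{L(x,y)}\right)=\sum_x\pi(x)\widetilde D_f(M(x,\cdot)\|L(x,\cdot))$, with the same conventions. $D_\alpha,\widetilde D_\alpha$ denote the case $f(t)=\frac{t^\alpha-1}{\alpha-1}$, and $\mathrm{TV}$ the case $f(t)=|t-1|/2$. Rényi divergences: $R_\alpha(M\|L):=\frac1{\alpha-1}\ln(1+(\alpha-1)D_\alpha(M\|L))$ and $\widetilde R_\alpha(\mu\|\nu):=\frac1{\alpha-1}\ln(1+(\alpha-1)\widetilde D_\alpha(\mu\|\nu))$. Ergodicity coefficients: $$\eta^f(P):=\sup_{M,L\in\mathcal{L},\,M\ne L}\frac{D_f(MP\|LP)}{D_f(M\|L)},\qquad \eta^{(R_\alpha)}(P):=\sup_{M,L\in\mathcal{L},\,M\ne L}\frac{R_\alpha(MP\|LP)}{R_\alpha(M\|L)},$$ $$\widetilde\eta^f(P):=\sup_{\mu,\nu\in\mathcal{P}(\mathcal{X}),\,\mu\ne\nu}\frac{\widetilde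 D_f(\mu P\|\nu P)}{\widetilde D_f(\mu\|\nu)},\qquad \widetilde\eta^{(R_\alpha)}(P):=\sup_{\mu,\nu\in\mathcal{P}(\mathcal{X}),\,\mu\ne\nu}\frac{\widetilde R_\alpha(\mu P\|\nu P)}{\widetilde R_\alpha(\mu\|\nu)}.$$ $\eta^{(\mathrm{TV})},\eta^{(D_\alpha)}$ (and the tilded versions) are the coefficients $\eta^f$ (resp. $\widetilde\eta^f$) for $f(t)=|t-1|/2$ and $f(t)=\frac{t^\alpha-1}{\alpha-1}$. $P$ is scrambling if for all $x,y\in\mathcal{X}$ there is $z\in\mathcal{X}$ with $P(x,z)>0$ and $P(y,z)>0$. $f$ is strictly convex at $1$ if $\lambda f(s)+(1-\lambda)f(t)>f(1)$ whenever $s<1<t$, $\lambda\in(0,1)$, $\lambda s+(1-\lambda)t=1$.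
   Formalization: In (iii) the upper bounds also assume D_α(U_n*‖V_n* )→D_α(U*‖V* ) (same for μ,ν; ∞/∞ read as limit); in (viii) scrambling ⇒ η^(R_β)<1 (and tilde) assumes all rows of P share one zero pattern; η^f<1 ⇒ scrambling assumes f is not c(t−1). *)

(* Defs.v *)
From mathcomp Require Import all_boot all_order all_algebra.
From mathcomp Require Import all_classical all_reals all_analysis.
Set Implicit Arguments.
Unset Strict Implicit.
Unset Printing Implicit Defensive.
Import Order.TTheory GRing.Theory Num.Theory.
Import numFieldNormedType.Exports.
Local Open Scope classical_set_scope.
Local Open Scope ring_scope.

(* The finite state space is 'I_n, a measure mu acts on functions from the
   left, so that mu P is the row vector mu *m P. *)

Definition is_pmf (R : realType) (n : nat) (mu : 'rV[R]_n) : Prop :=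
  (forall x, 0 <= mu 0 x) /\ \sum_x mu 0 x = 1.

Definition is_transition (R : realType) (n : nat) (M : 'M[R]_n) : Prop :=
  forall x, is_pmf (row x M).

Definition scrambling (R : realType) (n : nat) (P : 'M[R]_n) : Prop :=
  forall x y, exists z, 0 < P x z /\ 0 < P y z.

Definition common_support (R : realType) (n : nat) (P : 'M[R]_n) : Prop :=
  forall x y z, 0 < P x z -> 0 < P y z.

(* Generators f are functions on [0, +oo[; their values on negative reals are
   never used. *)

Definition convex_on_nonneg (R : realType) (f : R -> R) : Prop :=
  convex_function (`[0, +oo[ : set (convex_lmodType R^o)) f.

Definition strictly_convex_at1 (R : realType) (f : R -> R) : Prop :=
  forall s t lam : R, 0 <= s -> s < 1 -> 1 < t -> 0 < lam -> lam < 1 ->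
    lam * s + (1 - lam) * t = 1 -> f 1 < lam * f s + (1 - lam) * f t.

(* These generators give the zero divergence. *)
Definition trivial_generator (R : realType) (f : R -> R) : Prop :=
  exists c : R, forall t, 0 <= t -> f t = c * (t - 1).

Local Open Scope ereal_scope.

(* l f(m / l), with 0 f(0/0) = 0 and 0 f(m/0) = m lim_{u -> 0+} u f(1/u);
   the limit is taken in \bar R because it may be +oo. *)
Definition fdiv_term (R : realType) (f : R -> R) (m l : R) : \bar R :=
  if l != 0%R then (l * f (m / l))%:E
  else if m == 0%R then 0
  else m%:E * lim ((u * f u^-1)%:E @[u --> (0 : R)%R^'+]).

Definition fdivt (R : realType) (n : nat) (f : R -> R) (mu nu : 'rV[R]_n) :
    \bar R :=
  \sum_x fdiv_term f (mu 0%R x) (nu 0%R x).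

Definition fdiv (R : realType) (n : nat) (pi : 'rV[R]_n) (f : R -> R)
    (M L : 'M[R]_n) : \bar R :=
  \sum_x (pi 0%R x)%:E * fdivt f (row x M) (row x L).

Definition tv_gen (R : realType) (t : R) : R := (`|t - 1| / 2)%R.

Definition alpha_gen (R : realType) (alpha t : R) : R :=
  ((t `^ alpha - 1) / (alpha - 1))%R.

(* lne 0 = -oo and lne +oo = +oo, so a Renyi divergence can be +oo for
   alpha < 1 (mutually singular arguments) as well as for alpha > 1. *)
Definition renyi_of (R : realType) (alpha : R) (d : \bar R) : \bar R :=
  ((alpha - 1)^-1)%:E * lne (1 + (alpha - 1)%:E * d).

Definition renyit (R : realType) (n : nat) (alpha : R) (mu nu : 'rV[R]_n) :
    \bar R :=
  renyi_of alpha (fdivt (alpha_gen alpha) mu nu).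

Definition renyi (R : realType) (n : nat) (pi : 'rV[R]_n) (alpha : R)
    (M L : 'M[R]_n) : \bar R :=
  renyi_of alpha (fdiv pi (alpha_gen alpha) M L).

(* The division of \bar R gives 0 / 0 = 0 and +oo / +oo = 0, so that pairs
   whose divergence is 0 or +oo do not contribute when D contracts.
   The point 0 only matters when A has a single element: the supremum over no
   pair at all is then 0 rather than -oo. *)
Definition ergodicity_coeff (R : realType) (T : Type) (A : T -> Prop)
    (D : T -> T -> \bar R) (K : T -> T) : \bar R :=
  ereal_sup ([set 0] `|` [set r | exists p q : T,
    [/\ A p, A q, p <> q & r = D (K p) (K q) / D p q]]).

Definition eta (R : realType) (n : nat) (pi : 'rV[R]_n) (f : R -> R)
    (P : 'M[R]_n) : \bar R :=
  ergodicity_coeff (@is_transition R n) (fdiv pi f) (fun M => (M *m P)%R).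

Definition etaR (R : realType) (n : nat) (pi : 'rV[R]_n) (alpha : R)
    (P : 'M[R]_n) : \bar R :=
  ergodicity_coeff (@is_transition R n) (renyi pi alpha)
    (fun M => (M *m P)%R).

Definition etat (R : realType) (n : nat) (f : R -> R) (P : 'M[R]_n) : \bar R :=
  ergodicity_coeff (@is_pmf R n) (@fdivt R n f) (fun mu => (mu *m P)%R).

Definition etatR (R : realType) (n : nat) (alpha : R) (P : 'M[R]_n) : \bar R :=
  ergodicity_coeff (@is_pmf R n) (@renyit R n alpha) (fun mu => (mu *m P)%R).

(* ln(1 + (alpha - 1) e d) / ln(1 + (alpha - 1) d) for alpha > 1; at d = +oo
   this is its limit as d tends to +oo, which is 1 if e > 0 and 0 if e = 0. *)
Definition log_ratio (R : realType) (alpha : R) (e d : \bar R) : \bar R :=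
  if d == +oo then (if e == 0 then 0 else 1)
  else lne (1 + (alpha - 1)%:E * e * d) / lne (1 + (alpha - 1)%:E * d).

(* Main.v *)
(* The generator enters only through its perspective
   phi(m, l) = l f(m / l), which is sublinear on the closed quadrant, value at
   l = 0 included, and vanishes on the diagonal.  Transporting the positive part
   of mu - nu onto its negative part splits the pairs (mu x, nu x) into pieces
   matched two by two, the sum of each match being diagonal.  On a match
   attached to the states x and y, the overlap min(P x, P y) of the two rows only
   carries diagonal pairs, so sublinearity gives
   D(mu P, nu P) <= c D(mu, nu) whenever 1 - sum_z min(P x z, P y z) <= c for all
   x <> y.  The total variation distance attains this rate on two-point laws,
   hence eta^f <= eta^TV; the choice c = 1 is the data processing inequality.

   For alpha > 1 (resp. alpha < 1) the Renyi divergence is a concave (resp.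
   convex) function of D_alpha vanishing at 0, so a ratio of Renyi divergences is
   at least (resp. at most) the corresponding ratio of D_alpha.  For alpha < 1,
   D_alpha is an affine function of the Hellinger integral
   sum pi M^alpha L^(1 - alpha); the skew symmetry of the latter and Hoelder's
   inequality give the symmetry and the equivalence of the coefficients. *)

Require Import Defs.
From mathcomp Require Import all_boot all_order all_algebra.
From mathcomp Require Import all_classical all_reals all_analysis.
From mathcomp Require Import ring lra.
Import Order.TTheory GRing.Theory Num.Theory.
Import numFieldNormedType.Exports.
Set Implicit Arguments.
Unset Strict Implicit.
Unset Printing Implicit Defensive.
Local Open Scope classical_set_scope.
Local Open Scope ring_scope.

(** * Real inequalities and generators *)

Section real_inequalities.
Variable R : realType.
Implicit Types (f : R -> R) (a s t u v w x y : R).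

(** Two obstacles at orders above 1 shape the statement. The ratio of two Renyi divergences tends to
    1 when both blow up: if P x z > 0 = P y z, the laws delta_x and e delta_x + (1 - e) delta_y have
    divergence ln(1/e), and their images have at least ln(1/e) + ln(P x z) / (beta - 1). Letting e
    tend to 0, the coefficient is 1 even for a scrambling [P]. This is excluded by [common_support],
    which bounds the divergence of all images. Moreover D_alpha is not continuous at the boundary of
    the simplex: masses a_k and b_k that tend to 0 with a_k^alpha b_k^(1 - alpha) constant leave a
    positive divergence between laws with the same limit. Convergence of the divergences along an
    extremal sequence is therefore assumed along with pointwise convergence. In the scrambling
    criterion, the affine generators c (t - 1) are set apart because their divergence vanishes, so
    that their coefficient is 0 for every [P]. *)

Lemma convex_on_nonnegP f : convex_on_nonneg f <->
  forall t x y, 0 <= t -> t <= 1 -> 0 <= x -> 0 <= y ->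
    f (t * x + (1 - t) * y) <= t * f x + (1 - t) * f y.
Proof.
split=> [cf t x y t0 t1 x0 y0|cf t x y].
  have := cf (Itv01 t0 t1) x y; rewrite !inE/= !in_itv/= !andbT.
  by move=> /(_ x0 y0).
rewrite !inE/= !in_itv/= !andbT => x0 y0.
by apply: cf.
Qed.

(** Young's inequality for the product of u and 1, with conjugate exponents a and a / (a - 1),
    multiplied by a. *)
Lemma powR_bernoulli_ge a u : 1 < a -> 0 <= u -> 1 + a * (u - 1) <= u `^ a.
Proof.
move=> a1 u0; have a0 : 0 < a by lra.
have a10 : 0 < 1 - a^-1 by rewrite subr_gt0 invf_lt1.
have := @conjugate_powR R u 1 a (1 - a^-1)^-1 u0 ler01 a0.
rewrite invr_gt0 a10 invrK => /(_ isT).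
rewrite powR1 mulr1 mul1r => /(_ ltac:(lra)) h.
have := ler_wpM2l (ltW a0) h; rewrite mulrDr mulrBr mulrCA mulfV ?gt_eqF//.
by rewrite mulr1; lra.
Qed.

(** The preceding inequality with exponent 1 / a at the point u^a. The concave cases below are
    deduced from the convex ones by the same inversion. *)
Lemma powR_bernoulli_le a u : 0 < a -> a < 1 -> 0 <= u ->
  u `^ a <= 1 + a * (u - 1).
Proof.
move=> a0 a1 u0.
have a1' : 1 < a^-1 by rewrite invf_gt1.
have := powR_bernoulli_ge a1' (powR_ge0 u a).
rewrite -powRrM mulfV ?gt_eqF// powRr1// => h.
have := ler_wpM2l (ltW a0) h; rewrite mulrDr mulrA mulfV ?gt_eqF//; lra.
Qed.

(* Squaring Bernoulli's inequality at [Num.sqrt u] gains the strictly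
   positive term [a (a - 1) (Num.sqrt u - 1) ^+ 2]. *)
Lemma powR_bernoulli_gt a u : 1 < a -> 0 <= u -> u != 1 ->
  1 + a * (u - 1) < u `^ a.
Proof.
move=> a1 u0 u1.
have [s [s0 s1 ->]] : exists s, [/\ 0 <= s, s != 1 & u = s ^+ 2].
  exists (Num.sqrt u); rewrite sqrtr_ge0 sqr_sqrtr//; split=> //.
  by apply: contra u1 => /eqP h; rewrite -(sqr_sqrtr u0) h expr1n.
have s10 : 0 < (s - 1) ^+ 2 by rewrite exprn_even_gt0//= subr_eq0.
have -> : (s ^+ 2) `^ a = (s `^ a) ^+ 2 by rewrite !expr2 powRM.
have [h|h] := leP 0 (1 + a * (s - 1)); last first.
  apply: lt_le_trans (sqr_ge0 _).
  have := mulr_ge0 (_ : 0 <= - (a * (s - 1))) s0; rewrite oppr_ge0 => /(_ ltac:(lra)).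
  by rewrite expr2; lra.
have := powR_bernoulli_ge a1 s0 => hb.
have : (1 + a * (s - 1)) ^+ 2 <= (s `^ a) ^+ 2 by rewrite lerXn2r// nnegrE powR_ge0.
apply: lt_le_trans; rewrite -subr_gt0.
have -> : (1 + a * (s - 1)) ^+ 2 - (1 + a * (s ^+ 2 - 1)) =
  a * (a - 1) * (s - 1) ^+ 2 by ring.
have a0 : 0 < a by lra.
have a10 : 0 < a - 1 by lra.
exact: (mulr_gt0 (mulr_gt0 a0 a10) s10).
Qed.

Lemma powR_bernoulli_lt a u : 0 < a -> a < 1 -> 0 <= u -> u != 1 ->
  u `^ a < 1 + a * (u - 1).
Proof.
move=> a0 a1 u0 u1.
have a1' : 1 < a^-1 by rewrite invf_gt1.
have ua1 : u `^ a != 1.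
  by rewrite powR_eq1 !negb_or u1 -leNgt u0 gt_eqF.
have := powR_bernoulli_gt a1' (powR_ge0 u a) ua1.
rewrite -powRrM mulfV ?gt_eqF// powRr1// => h.
have := h; rewrite -(ltr_pM2l a0) mulrDr mulrA mulfV ?gt_eqF//; lra.
Qed.

Lemma convex_powR_conv a t x y : 1 < a -> 0 <= t -> t <= 1 -> 0 <= x -> 0 <= y ->
  (t * x + (1 - t) * y) `^ a <= t * x `^ a + (1 - t) * y `^ a.
Proof.
move=> a1 t0 t1 x0 y0.
have /(_ (Itv01 t0 t1) x y) := @convex_powR R a (ltW a1).
by rewrite !inE/= !in_itv/= !andbT => /(_ x0 y0).
Qed.

Lemma concave_powR_conv a t x y : 0 < a -> a < 1 ->
  0 <= t -> t <= 1 -> 0 <= x -> 0 <= y ->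
  t * x `^ a + (1 - t) * y `^ a <= (t * x + (1 - t) * y) `^ a.
Proof.
move=> a0 a1 t0 t1 x0 y0.
have a1' : 1 < a^-1 by rewrite invf_gt1.
have := convex_powR_conv a1' t0 t1 (powR_ge0 x a) (powR_ge0 y a).
rewrite -!powRrM mulfV ?gt_eqF// !powRr1// => h.
have h0 : 0 <= t * x `^ a + (1 - t) * y `^ a.
  by rewrite addr_ge0// mulr_ge0// ?powR_ge0//; lra.
move: h h0; set z := t * _ + _ => h h0.
rewrite (_ : z = (z `^ a^-1) `^ a); last by rewrite -powRrM mulVf ?gt_eqF// powRr1.
apply: ge0_ler_powR => //; first exact: ltW.
- by rewrite nnegrE powR_ge0.
- by rewrite nnegrE addr_ge0// mulr_ge0//; lra.
Qed.

Lemma alpha_gen_convex a : 0 < a -> a <> 1 -> convex_on_nonneg (alpha_gen a).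
Proof.
move=> a0 /eqP a1; apply/convex_on_nonnegP => t x y t0 t1 x0 y0.
rewrite /alpha_gen.
rewrite [leRHS](_ : _ = (t * x `^ a + (1 - t) * y `^ a - 1) / (a - 1)); last first.
  by rewrite !mulrA -mulrDl; congr (_ / _); ring.
case/orP: (lt_total a1) => h.
  rewrite ler_ndivrMr ?subr_lt0// mulfVK ?subr_eq0 ?lt_eqF//.
  by rewrite lerB// concave_powR_conv.
rewrite ler_pM2r ?invr_gt0 ?subr_gt0// lerB//.
exact: convex_powR_conv.
Qed.

Lemma alpha_gen1 a : alpha_gen a 1 = 0.
Proof. by rewrite /alpha_gen powR1 subrr mul0r. Qed.

Lemma alpha_gen_strictly_convex_at1 a : 0 < a -> a <> 1 ->
  strictly_convex_at1 (alpha_gen a).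
Proof.
move=> a0 /eqP a1 s t l s0 s1 t1 l0 l1 st; rewrite alpha_gen1 /alpha_gen.
rewrite !mulrA -mulrDl.
have h0 : (l * s + (1 - l) * t - 1) * a = 0 by rewrite st subrr mul0r.
case/orP: (lt_total a1) => h.
  rewrite -mulrNN -invrN mulr_gt0// ?invr_gt0 ?oppr_gt0 ?subr_lt0//.
  have hs := powR_bernoulli_lt a0 h s0 (negbT (lt_eqF s1)).
  have ht := powR_bernoulli_lt a0 h (ltW (lt_trans ltr01 t1)) (negbT (gt_eqF t1)).
  have l1' : 0 < 1 - l by lra.
  rewrite -(ltr_pM2l l0) in hs; rewrite -(ltr_pM2l l1') in ht.
  lra.
rewrite mulr_gt0// ?invr_gt0 ?subr_gt0//.
have hs := powR_bernoulli_gt h s0 (negbT (lt_eqF s1)).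
have ht := powR_bernoulli_gt h (ltW (lt_trans ltr01 t1)) (negbT (gt_eqF t1)).
have l1' : 0 < 1 - l by lra.
rewrite -(ltr_pM2l l0) in hs; rewrite -(ltr_pM2l l1') in ht.
lra.
Qed.

Lemma strictly_convex_at1_nontrivial f : f 1 = 0 ->
  strictly_convex_at1 f -> ~ trivial_generator f.
Proof.
move=> f1 sf [c fc].
have h12 : (0 : R) < 1 / 2 by lra.
have h21 : 1 / 2 < (1 : R) by lra.
have := sf 0 2 (1 / 2) (lexx _) ltr01 (ltr1n _ 2) h12 h21 ltac:(lra).
by rewrite f1 !fc//; lra.
Qed.

Lemma tv_gen_convex : convex_on_nonneg (@tv_gen R).
Proof.
apply/convex_on_nonnegP => t x y t0 t1 x0 y0; rewrite /tv_gen !mulrA -mulrDl.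
rewrite ler_pM2r ?invr_gt0//.
have -> : t * x + (1 - t) * y - 1 = t * (x - 1) + (1 - t) * (y - 1) by ring.
have t1' : 0 <= 1 - t by lra.
by rewrite (le_trans (ler_normD _ _))// !normrM (ger0_norm t0) (ger0_norm t1').
Qed.

Lemma tv_gen1 : @tv_gen R 1 = 0.
Proof. by rewrite /tv_gen subrr normr0 mul0r. Qed.

(** Logarithm of Bernoulli's inequality (1 + x)^t <= 1 + t x. *)
Lemma ln_ge_chord t x : 0 <= t -> t <= 1 -> -1 < x ->
  t * ln (1 + x) <= ln (1 + t * x).
Proof.
move=> t0 t1 x1.
have [->|tn0] := eqVneq t 0; first by rewrite !mul0r addr0 ln1.
have [->|tn1] := eqVneq t 1; first by rewrite !mul1r.
have x0 : 0 < 1 + x by lra.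
have tlt1 : t < 1 by rewrite lt_neqAle tn1.
have tgt0 : 0 < t by rewrite lt_neqAle eq_sym tn0.
have := powR_bernoulli_le tgt0 tlt1 (ltW x0).
rewrite -ln_powR (_ : 1 + x - 1 = x); last by ring.
move=> h; rewrite ler_ln// posrE ?powR_gt0//.
exact: lt_le_trans (powR_gt0 _ x0) h.
Qed.

(** Weighted arithmetic-geometric inequality: Bernoulli at w / u, multiplied by u. *)
Lemma powR_young s u w : 0 < s -> s < 1 -> 0 <= u -> 0 <= w ->
  u `^ (1 - s) * w `^ s <= (1 - s) * u + s * w.
Proof.
move=> s0 s1 u0 w0.
have [->|un0] := eqVneq u 0.
  by rewrite powR0 ?subr_eq0 ?gt_eqF// mul0r mulr0 add0r mulr_ge0// ltW.
have ug0 : 0 < u by rewrite lt_neqAle eq_sym un0.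
have := powR_bernoulli_le s0 s1 (divr_ge0 w0 u0).
move=> /(ler_wpM2l u0).
have -> : u * (1 + s * (w / u - 1)) = (1 - s) * u + s * w by field.
apply: le_trans.
rewrite powRM// ?invr_ge0// -powR_inv1// -powRrM powRD; last by rewrite un0 implybT.
by rewrite powRr1// mulN1r -mulrA [_ * w `^ s]mulrC.
Qed.

End real_inequalities.

(** * The perspective of a convex generator *)

Section perspective.
Variables (R : realType) (f : R -> R).
Hypothesis cf : convex_on_nonneg f.
Implicit Types (c h l m t : R).

(** Convexity at t <= t + h < T with denominators cleared, ready for T = 1 / u with u tending to
    0. *)
Lemma convex_slope_le t h T : 0 <= t -> 0 <= h -> t + h < T ->
  (T - t) * f (t + h) <= (T - t - h) * f t + h * f T.
Proof.
move=> t0 h0 thT; have T0 : 0 < T - t by lra.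
have l0 : 0 <= h / (T - t) by exact: divr_ge0 h0 (ltW T0).
have l1 : h / (T - t) <= 1 by rewrite ler_pdivrMr// mul1r; lra.
have TN0 : T - t != 0 by rewrite gt_eqF.
have Tge0 : 0 <= T by lra.
have := (convex_on_nonnegP f).1 cf _ T t l0 l1 Tge0 t0.
have -> : h / (T - t) * T + (1 - h / (T - t)) * t = t + h by field.
move=> /(ler_wpM2l (ltW T0))/le_trans; apply.
by rewrite le_eqVlt; apply/predU1P; left; field.
Qed.

(** Slope of [f] at infinity, the limit of f(T) / T with T = 1 / u; it is the value of the
    perspective at (1, 0). *)
Definition recession : \bar R :=
  lim ((u * f u^-1)%:E @[u --> (0 : R)^'+]).

(** u (f(1/u) - f(0)) is the slope of the chord over [0, 1/u], nonincreasing in u by convexity, so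
    it has a limit in \bar R; the correction u f(0) tends to 0. *)
Lemma is_cvg_recession : cvg ((u * f u^-1)%:E @[u --> (0 : R)^'+]).
Proof.
have cvg1 : cvg ((u * (f u^-1 - f 0))%:E @[u --> (0 : R)^'+]).
  apply: nonincreasing_at_right_is_cvge; near=> b.
  move=> u v; rewrite !in_itv/= => /andP[u0 _] /andP[v0 _] uv; rewrite lee_fin.
  move: uv; rewrite le_eqVlt => /predU1P[->//|uv].
  have vu : v^-1 < u^-1 by rewrite ltf_pV2// posrE.
  have := @convex_slope_le 0 v^-1 u^-1 (lexx _).
  rewrite add0r !subr0 => /(_ _ vu); rewrite invr_ge0 => /(_ (ltW v0)).
  move=> /(ler_wpM2l (ltW (mulr_gt0 u0 v0))) H.
  have uN0 : u != 0 by rewrite gt_eqF.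
  have vN0 : v != 0 by rewrite gt_eqF.
  have E1 : u * v * (u^-1 * f v^-1) = v * f v^-1 by field.
  have E2 : u * v * ((u^-1 - v^-1) * f 0 + v^-1 * f u^-1) =
    (v - u) * f 0 + u * f u^-1.
    by field; rewrite uN0 vN0.
  by rewrite E1 E2 in H; lra.
have cvg2 : (u * f 0)%:E @[u --> (0 : R)^'+] --> 0%E.
  apply: cvg_EFin; first exact: nearW.
  rewrite -[X in _ --> X](mul0r (f 0)).
  by apply: cvgMl; apply: cvg_at_right_filter; exact: cvg_id.
have -> : (fun u => (u * f u^-1)%:E) =
   (fun u => (u * (f u^-1 - f 0))%:E) \+ (fun u => (u * f 0)%:E).
  by apply/funext => u /=; rewrite -EFinD; congr EFin; ring.
apply/cvg_ex; eexists; apply: cvgeD cvg1 cvg2.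
by rewrite fin_num_adde_defl.
Unshelve. all: by end_near. Qed.

(** Chord slopes of a convex function never exceed its slope at infinity. *)
Lemma recession_ge t h : 0 <= t -> 0 < h ->
  ((f (t + h))%:E <= (f t)%:E + h%:E * recession)%E.
Proof.
move=> t0 h0.
suff : (((f (t + h) - f t) / h)%:E <= recession)%E.
  move=> /(lee_wpmul2l (ltW h0 : (0 <= h%:E)%E)).
  rewrite -EFinM mulrC divfK ?gt_eqF// EFinB leeBlDr//.
  by rewrite addeC.
have [//|] := leP (((f (t + h) - f t) / h)%:E) recession.
set S := (f (t + h) - f t) / h => hlt.
(* This is u times the height at 1 / u of the line through (t, f t) with slope [S]; beyond t + h
   that line lies below [f]. *)
have cS : (u * f t + (1 - u * t) * S)%:E @[u --> (0 : R)^'+] --> S%:E.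
  apply: cvg_EFin; first exact: nearW.
  rewrite -[X in _ --> X](_ : 0 * f t + (1 - 0 * t) * S = _); last by ring.
  apply: cvgD; first by apply: cvgMl; apply: cvg_at_right_filter; exact: cvg_id.
  apply: cvgMl; apply: cvgB; first exact: cvg_cst.
  by apply: cvgMl; apply: cvg_at_right_filter; exact: cvg_id.
suff : (S%:E <= recession)%E by rewrite leNgt hlt.
apply: (lee_cvg_to cS is_cvg_recession).
near=> u; rewrite lee_fin.
have u0 : 0 < u by near: u; exact: nbhs_right_gt.
have hu : t + h < u^-1.
  rewrite -[_ + h]invrK ltf_pV2 ?posrE ?invr_gt0 ?ltr_wpDl//.
  near: u; apply: nbhs_right_lt; rewrite invr_gt0; exact: ltr_wpDl.
have := convex_slope_le t0 (ltW h0) hu => /(ler_wpM2l (ltW u0)) H.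
rewrite -(ler_pM2l h0); move: H; set F := f (t + h).
have -> : h * (u * f t + (1 - u * t) * S) = h * u * f t + (1 - u * t) * (h * S) by ring.
have -> : h * S = F - f t by rewrite /S mulrC divfK// gt_eqF.
have uN0 : u != 0 by rewrite gt_eqF.
have -> : u * ((u^-1 - t) * F) = (1 - u * t) * F by field.
have -> : u * ((u^-1 - t - h) * f t + h * f u^-1) =
  (1 - u * t - u * h) * f t + h * (u * f u^-1) by field.
lra.
Unshelve. all: by end_near. Qed.

Lemma recession_Ny : recession != -oo%E.
Proof.
have := recession_ge (lexx 0) ltr01; rewrite mul1e.
by case: recession => //; rewrite addeNy.
Qed.

Lemma fdiv_term_neq0 m l : l != 0 -> fdiv_term f m l = (l * f (m / l))%:E.
Proof. by rewrite /fdiv_term => ->. Qed.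

Lemma fdiv_term0 m : fdiv_term f m 0 = (m%:E * recession)%E.
Proof.
by rewrite /fdiv_term eqxx/=; case: eqP => // ->; rewrite mul0e.
Qed.

Lemma fdiv_term_Ny m l : 0 <= m -> fdiv_term f m l != -oo%E.
Proof.
move=> m0; have [->|l0] := eqVneq l 0; last by rewrite fdiv_term_neq0.
rewrite fdiv_term0; case: recession recession_Ny => //= _.
by rewrite mulry; case: sgrP m0 => //= ?; rewrite ?mul0e ?mul1e.
Qed.

Lemma fdiv_termZ c m l : 0 <= c ->
  fdiv_term f (c * m) (c * l) = (c%:E * fdiv_term f m l)%E.
Proof.
move=> c0; have [->|cN0] := eqVneq c 0.
  by rewrite !mul0r fdiv_term0 !mul0e.
have [->|l0] := eqVneq l 0; first by rewrite mulr0 !fdiv_term0 muleA.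
rewrite !fdiv_term_neq0 ?mulf_neq0// -EFinM mulrA; congr (_ * f _)%:E.
by field; rewrite l0.
Qed.

(** Subadditivity when one pair lies on the edge l = 0: [recession_ge] at the quotients by [l1],
    rescaled. The edge needs its own argument because the value there is a limit. *)
Lemma fdiv_termD0 m1 l1 m2 : 0 <= m1 -> 0 <= l1 -> 0 <= m2 ->
  (fdiv_term f (m1 + m2) l1 <= fdiv_term f m1 l1 + fdiv_term f m2 0)%E.
Proof.
move=> m10 l10 m20; have [->|l1N0] := eqVneq l1 0.
  by rewrite !fdiv_term0 EFinD ge0_muleDl.
have l1_gt0 : 0 < l1 by rewrite lt_neqAle eq_sym l1N0.
rewrite 2?fdiv_term_neq0// fdiv_term0.
have := m20; rewrite le_eqVlt => /predU1P[<-|m2_gt0].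
  by rewrite addr0 mul0e adde0.
have := recession_ge (divr_ge0 m10 l10) (divr_gt0 m2_gt0 l1_gt0).
rewrite -mulrDl => /(lee_wpmul2l (l10 : (0 <= l1%:E)%E)).
rewrite -EFinM => /le_trans; apply.
rewrite muleDr// ?fin_num_adde_defr// muleA -!EFinM.
by rewrite [l1 * (m2 / l1)]mulrC divfK.
Qed.

(** Off the edge, (m1 + m2) / (l1 + l2) is the average of the two quotients with weights
    proportional to [l1] and [l2], and convexity applies. *)
Lemma fdiv_termD m1 l1 m2 l2 : 0 <= m1 -> 0 <= l1 -> 0 <= m2 -> 0 <= l2 ->
  (fdiv_term f (m1 + m2) (l1 + l2) <= fdiv_term f m1 l1 + fdiv_term f m2 l2)%E.
Proof.
move=> m10 l10 m20 l20.
have [->|l2N0] := eqVneq l2 0; first by rewrite addr0 fdiv_termD0.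
have [->|l1N0] := eqVneq l1 0.
  by rewrite add0r addrC addeC fdiv_termD0.
have l1_gt0 : 0 < l1 by rewrite lt_neqAle eq_sym l1N0.
have l2_gt0 : 0 < l2 by rewrite lt_neqAle eq_sym l2N0.
have s0 : 0 < l1 + l2 by rewrite addr_gt0.
have sN0 : l1 + l2 != 0 by rewrite gt_eqF.
rewrite !fdiv_term_neq0// -EFinD lee_fin.
have t0 : 0 <= l1 / (l1 + l2) by rewrite divr_ge0// ltW.
have t1 : l1 / (l1 + l2) <= 1 by rewrite ler_pdivrMr// mul1r lerDl.
have := (convex_on_nonnegP f).1 cf _ _ _ t0 t1 (divr_ge0 m10 l10) (divr_ge0 m20 l20).
move=> /(ler_wpM2l (ltW s0)).
have -> : l1 / (l1 + l2) * (m1 / l1) + (1 - l1 / (l1 + l2)) * (m2 / l2) =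
  (m1 + m2) / (l1 + l2) by field; rewrite ?sN0 ?l1N0 ?l2N0.
move=> /le_trans; apply; rewrite le_eqVlt; apply/predU1P; left.
by field.
Qed.

Lemma fdiv_term_diag c : f 1 = 0 -> fdiv_term f c c = 0%E.
Proof.
move=> f1; have [->|c0] := eqVneq c 0; first by rewrite fdiv_term0 mul0e.
by rewrite fdiv_term_neq0// divff// f1 mulr0.
Qed.

Lemma fdiv_term_sum (I : Type) (r : seq I) (k m l : I -> R) (v : I -> R) :
  (forall i, 0 <= k i) -> (forall i, 0 <= m i) -> (forall i, 0 <= l i) ->
  (forall i, (fdiv_term f (m i) (l i) <= (v i)%:E)%E) ->
  (fdiv_term f (\sum_(i <- r) k i * m i) (\sum_(i <- r) k i * l i)
     <= (\sum_(i <- r) k i * v i)%:E)%E.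
Proof.
move=> k0 m0 l0 fv; elim: r => [|i r IH].
  by rewrite !big_nil fdiv_term0 mul0e.
rewrite !big_cons EFinD.
apply: le_trans (fdiv_termD _ _ _ _) _; rewrite ?mulr_ge0//.
- by rewrite sumr_ge0// => j _; rewrite mulr_ge0.
- by rewrite sumr_ge0// => j _; rewrite mulr_ge0.
by apply: leeD => //; rewrite fdiv_termZ// EFinM lee_wpmul2l// lee_fin.
Qed.

End perspective.

(** * Contraction of divergences by a transition matrix *)

Section pmf.
Variables (R : realType) (n : nat).
Implicit Types (mu nu : 'rV[R]_n) (M L P : 'M[R]_n).

Lemma pmf_ge0 mu x : is_pmf mu -> 0 <= mu 0 x. Proof. by case. Qed.

Lemma transition_ge0 P x y : is_transition P -> 0 <= P x y.
Proof. by move=> hP; have [/(_ y)] := hP x; rewrite mxE. Qed.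

Lemma transition_sum P x : is_transition P -> \sum_y P x y = 1.
Proof. by move=> hP; have [_] := hP x; under eq_bigr do rewrite mxE. Qed.

Lemma pmf_mulmx mu P : is_pmf mu -> is_transition P -> is_pmf (mu *m P).
Proof.
move=> [mu0 mu1] hP; split=> [y|].
  by rewrite mxE sumr_ge0// => x _; rewrite mulr_ge0// transition_ge0.
under eq_bigr do rewrite mxE.
rewrite exchange_big/= -[RHS]mu1; apply: eq_bigr => x _.
by rewrite -mulr_sumr transition_sum// mulr1.
Qed.

Lemma transition_mulmx M P : is_transition M -> is_transition P ->
  is_transition (M *m P).
Proof. by move=> hM hP x; rewrite row_mul; exact: pmf_mulmx. Qed.

Lemma transition_cst mu : is_pmf mu ->
  is_transition (\matrix_(x < n, y < n) mu 0 y).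
Proof.
move=> hmu x; suff -> : row x (\matrix_(x < n, y < n) mu 0 y) = mu by [].
by apply/rowP => y; rewrite !mxE.
Qed.

Lemma transition_conv P1 P2 (t : R) : is_transition P1 -> is_transition P2 ->
  0 <= t -> t <= 1 -> is_transition (t *: P1 + (1 - t) *: P2).
Proof.
move=> h1 h2 t0 t1 x; have t1' : 0 <= 1 - t by lra.
split=> [y|].
  by rewrite !mxE addr_ge0// mulr_ge0// transition_ge0.
under eq_bigr do rewrite !mxE.
by rewrite big_split/= -!mulr_sumr !transition_sum//; lra.
Qed.

End pmf.

(** Twice the sum is the sum of F plus its transpose. This is what allows the transport below to be
    estimated one match at a time. *)
Lemma symmetric_sum_ge0 (R : realType) (I : finType) (F : I -> I -> R) :
  (forall i j, 0 <= F i j + F j i) -> 0 <= \sum_i \sum_j F i j.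
Proof.
move=> F0; rewrite -(@pmulr_rge0 _ 2)// mulr_natl mulr2n.
rewrite [X in _ + X]exchange_big/= -big_split/= sumr_ge0// => i _.
by rewrite -big_split/= sumr_ge0.
Qed.

Lemma antisymmetric_sum (R : realType) (I : finType) (F : I -> I -> R) :
  (forall i j, F i j + F j i = 0) -> \sum_i \sum_j F i j = 0.
Proof.
move=> F0; apply/eqP; rewrite eq_le -oppr_ge0 symmetric_sum_ge0 ?andbT.
- rewrite -sumrN; under eq_bigr do rewrite -sumrN.
  by apply: symmetric_sum_ge0 => i j; rewrite -opprD F0 oppr0.
- by move=> i j; rewrite F0.
Qed.

Section divergence.
Variables (R : realType) (n : nat) (f : R -> R).
Hypotheses (cf : convex_on_nonneg f) (f1 : f 1 = 0).
Implicit Types (mu nu : 'rV[R]_n) (P : 'M[R]_n).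

(** The log-sum inequality for a general generator. Summed over all states it compares the
    divergence of two laws with the term of (1, 1), which vanishes. *)
Lemma fdiv_term_esum (I : Type) (r : seq I) (A : pred I) (m l : I -> R) :
  (forall i, 0 <= m i) -> (forall i, 0 <= l i) ->
  (fdiv_term f (\sum_(i <- r | A i) m i) (\sum_(i <- r | A i) l i)
     <= \sum_(i <- r | A i) fdiv_term f (m i) (l i))%E.
Proof.
move=> m0 l0; elim: r => [|i r IH].
  by rewrite !big_nil fdiv_term0 mul0e.
rewrite !big_cons; case: ifP => // Ai.
apply: le_trans (fdiv_termD _ _ _ _ _) _ => //; rewrite ?sumr_ge0//.
by rewrite leeD2l.
Qed.

Lemma fdivt_ge0 mu nu : is_pmf mu -> is_pmf nu -> (0 <= fdivt f mu nu)%E.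
Proof.
move=> [mu0 mu1] [nu0 nu1].
have := fdiv_term_esum (index_enum 'I_n) xpredT mu0 nu0.
by rewrite mu1 nu1 fdiv_term_diag.
Qed.

Lemma fdivtxx mu : fdivt f mu mu = 0%E.
Proof. by rewrite /fdivt big1// => x _; rewrite fdiv_term_diag. Qed.

Lemma fdiv_term_fin mu nu x : is_pmf mu -> is_pmf nu ->
  fdivt f mu nu != +oo%E -> fdiv_term f (mu 0 x) (nu 0 x) \is a fin_num.
Proof.
move=> hmu hnu; rewrite fin_numE fdiv_term_Ny ?pmf_ge0//=.
apply: contra => /eqP hx; apply/eqP/esum_eqyP.
  by move=> i _; rewrite fdiv_term_Ny ?pmf_ge0.
by exists x; rewrite mem_index_enum.
Qed.

Section contraction.
Variables (P : 'M[R]_n) (c : R) (mu nu : 'rV[R]_n) (d : R).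
Hypothesis hP : is_transition P.
Hypothesis hc :
  forall x y, x != y -> 1 - \sum_z Num.min (P x z) (P y z) <= c.
Hypotheses (hmu : is_pmf mu) (hnu : is_pmf nu).
Hypothesis hd : fdivt f mu nu = d%:E.

Let a x := mu 0 x - nu 0 x.
Let T := (\sum_x `|a x|) / 2.
(* A transport of the positive part of [mu - nu] onto its negative part: the
   fraction [E x y] of the pair [(mu x, nu x)] is matched with the fraction
   [E y x] of [(mu y, nu y)], and the two fractions add up to a pair with equal
   components, which carries no divergence. *)
Let E x y := if a x * a y < 0 then `|a y| / T else 0.
Let v x := fine (fdiv_term f (mu 0 x) (nu 0 x)).

Let T_ge0 : 0 <= T.
Proof. by rewrite divr_ge0// sumr_ge0. Qed.

Let E_ge0 x y : 0 <= E x y.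
Proof. by rewrite /E; case: ifP => // _; rewrite divr_ge0. Qed.

Let sum_a : \sum_x a x = 0.
Proof. by rewrite sumrB; case: hmu => _ ->; case: hnu => _ ->; rewrite subrr. Qed.

Let sum_E x : a x != 0 -> \sum_y E x y = 1.
Proof.
move=> ax.
have T0 : T != 0.
  apply: contra ax; rewrite mulf_eq0 invr_eq0 pnatr_eq0 orbF.
  by rewrite psumr_eq0// => /allP/(_ x (mem_index_enum _)); rewrite normr_eq0.
(* The indicator of opposite signs times |a y| is (|a y| - sg(a x) a y) / 2; the signed part sums to
   0 and the rest to [T]. *)
have -> : \sum_y E x y = \sum_y ((`|a y| - Num.sg (a x) * a y) / 2 / T).
  apply: eq_bigr => y _; rewrite /E.
  have [ax0|ax0|ax0] := ltgtP (a x) 0; last by rewrite ax0 eqxx in ax.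
    rewrite ltr0_sg// nmulr_rlt0//.
    have [ay|ay|->] := ltgtP (a y) 0.
    by rewrite ltr0_norm//; field.
    by rewrite gtr0_norm//; field.
    by rewrite normr0; field.
  rewrite gtr0_sg// pmulr_rlt0//.
  have [ay|ay|->] := ltgtP (a y) 0.
    by rewrite ltr0_norm//; field.
    by rewrite gtr0_norm//; field.
    by rewrite normr0; field.
rewrite -!mulr_suml sumrB -mulr_sumr sum_a mulr0 subr0 -/T divff//.
Qed.

Let E_a0 x y : a x = 0 -> E x y = 0.
Proof. by move=> ax; rewrite /E ax mul0r ltxx. Qed.

Let sum_E_mul x r : (a x = 0 -> r = 0) -> \sum_y E x y * r = r.
Proof.
rewrite -mulr_suml; have [ax|ax] := eqVneq (a x) 0.
  by move=> ->//; rewrite mulr0.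
by rewrite sum_E// mul1r.
Qed.

Let sum_E_le1 x : \sum_y E x y <= 1.
Proof.
have [ax|ax] := eqVneq (a x) 0; last by rewrite sum_E.
by rewrite big1// => y _; rewrite E_a0.
Qed.

(** Both products have absolute value |a x| |a y| / T when the signs differ, and they have opposite
    signs. *)
Let E_asym x y : E x y * a x + E y x * a y = 0.
Proof.
rewrite /E [a y * a x]mulrC; case: ifPn => [|_]; last by rewrite !mul0r addr0.
have [ax|ax|ax] := ltgtP (a x) 0; last by rewrite ax mul0r ltxx.
  by rewrite nmulr_rlt0// => ay; rewrite (gtr0_norm ay) (ltr0_norm ax); ring.
by rewrite pmulr_rlt0// => ay; rewrite (ltr0_norm ay) (gtr0_norm ax); ring.
Qed.

Let fterm_v x : fdiv_term f (mu 0 x) (nu 0 x) = (v x)%:E.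
Proof. by rewrite fineK// fdiv_term_fin// hd. Qed.

Let v0 x : a x = 0 -> v x = 0.
Proof. by move/eqP; rewrite subr_eq0 /v => /eqP ->; rewrite fdiv_term_diag. Qed.

Let d_sum : d = \sum_x v x.
Proof.
apply: EFin_inj; rewrite -hd -sumEFin; apply: eq_bigr => x _.
exact: fterm_v.
Qed.

(** A single [v x] may be negative; only the sum over a match has a sign, which is why the last
    comparison is made match by match. *)
Let pair_ge0 x y : 0 <= E x y * v x + E y x * v y.
Proof.
rewrite -lee_fin EFinD !EFinM -!fterm_v -!fdiv_termZ//.
apply: le_trans (fdiv_termD _ _ _ _ _); rewrite ?mulr_ge0 ?pmf_ge0//.
have -> : E x y * mu 0 x + E y x * mu 0 y = E x y * nu 0 x + E y x * nu 0 y.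
  by apply/eqP; rewrite -subr_eq0 -(E_asym x y) /a; apply/eqP; ring.
by rewrite fdiv_term_diag.
Qed.

(** [rho x y] is what is left of row x once its overlap with row y is removed, and [K x] averages
    these remainders over the states matched with x. Thus [P x z - K x z] is the mass sent through
    overlaps, or the whole row when [a x] is 0. *)
Let rho x y z := P x z - Num.min (P x z) (P y z).
Let K x z := \sum_y E x y * rho x y z.

Let rho_ge0 x y z : 0 <= rho x y z.
Proof. by rewrite subr_ge0 ge_min lexx. Qed.

Let K_ge0 x z : 0 <= K x z.
Proof. by rewrite sumr_ge0// => y _; rewrite mulr_ge0. Qed.

Let K_le x z : K x z <= P x z.
Proof.
apply: (@le_trans _ _ (\sum_y E x y * P x z)).
  apply: ler_sum => y _; rewrite ler_wpM2l// gerBl le_min.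
  by rewrite !transition_ge0.
by rewrite -mulr_suml ler_piMl// transition_ge0.
Qed.

(** The overlap of two rows is symmetric in x and y while the matched excess is antisymmetric, so
    the mass sent through overlaps to z is the same under [mu] and [nu]. *)
Let balanced z : \sum_x (P x z - K x z) * a x = 0.
Proof.
rewrite -[RHS](@antisymmetric_sum _ _
  (fun x y => E x y * a x * Num.min (P x z) (P y z))) => [|x y].
  apply: eq_bigr => x _; rewrite mulrBl /K mulr_suml.
  rewrite -[P x z * a x](sum_E_mul (x := x)); last by move=> ->; rewrite mulr0.
  by rewrite -sumrB; apply: eq_bigr => y _; rewrite /rho; ring.
by rewrite [Num.min (P y z) _]minC -mulrDl E_asym mul0r.
Qed.

Let fterm_le z :
  (fdiv_term f ((mu *m P) 0%R z) ((nu *m P) 0%R z) <= (\sum_x K x z * v x)%:E)%E.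
Proof.
(* By [balanced], the overlaps contribute the diagonal pair (C, C) at z, which costs nothing; only
   the remainders [K] count. *)
set C := \sum_x (P x z - K x z) * mu 0 x.
have muE : (mu *m P) 0 z = \sum_x K x z * mu 0 x + C.
  by rewrite mxE -big_split; apply: eq_bigr => x _ /=; ring.
have nuE : (nu *m P) 0 z = \sum_x K x z * nu 0 x + C.
  have -> : C = \sum_x (P x z - K x z) * nu 0 x.
    apply: subr0_eq; rewrite /C -sumrB -[RHS](balanced z).
    by apply: eq_bigr => x _; rewrite /a; ring.
  by rewrite mxE -big_split; apply: eq_bigr => x _ /=; ring.
have C0 : 0 <= C.
  by rewrite sumr_ge0// => x _; rewrite mulr_ge0 ?pmf_ge0// subr_ge0.
rewrite muE nuE; apply: le_trans (fdiv_termD _ _ _ _ _) _ => //.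
- by rewrite sumr_ge0// => x _; rewrite mulr_ge0 ?pmf_ge0.
- by rewrite sumr_ge0// => x _; rewrite mulr_ge0 ?pmf_ge0.
rewrite [X in (_ + X)%E]fdiv_term_diag// adde0.
by apply: fdiv_term_sum => // x; rewrite ?pmf_ge0// fterm_v.
Qed.

Lemma fdivt_contraction : (fdivt f (mu *m P) (nu *m P) <= (c * d)%:E)%E.
Proof.
apply: (@le_trans _ _ (\sum_z \sum_x K x z * v x)%:E).
  by rewrite -sumEFin; apply: lee_sum => z _; exact: fterm_le.
rewrite lee_fin exchange_big/=.
set th := fun x y => \sum_z rho x y z.
have thE x y : th x y = 1 - \sum_z Num.min (P x z) (P y z).
  by rewrite /th sumrB transition_sum.
have -> : \sum_x \sum_z K x z * v x = \sum_x \sum_y E x y * v x * th x y.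
  apply: eq_bigr => x _; rewrite -mulr_suml exchange_big/= mulr_suml.
  by apply: eq_bigr => y _; rewrite -mulr_sumr /th; ring.
have -> : c * d = \sum_x \sum_y E x y * v x * c.
  rewrite d_sum mulr_sumr; apply: eq_bigr => x _.
  by rewrite -mulr_suml sum_E_mul 1?mulrC//; exact: v0.
rewrite -subr_ge0 -sumrB.
under eq_bigr do rewrite -sumrB.
apply: symmetric_sum_ge0 => x y.
(* Since all rows have mass 1, the remaining mass [th] is symmetric; each match then contributes
   [pair_ge0] times c - th x y, a product of nonnegative factors. *)
have -> : th y x = th x y by rewrite !thE; under eq_bigr do rewrite minC.
rewrite -!mulrBr -mulrDl; have [->|xy] := eqVneq x y.
  by rewrite {1 2}/E ltNge sqr_ge0 !mul0r addr0 mul0r.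
by rewrite mulr_ge0// subr_ge0 thE hc.
Qed.

End contraction.
End divergence.

(** * Abstract ergodicity coefficients *)

Section ergodicity_coefficient.
Variables (R : realType) (T : Type) (A : T -> Prop).
Implicit Types (D : T -> T -> \bar R) (K : T -> T) (p q : T) (b d : R).

(** Common ground for laws and matrices, for D_f and Renyi divergences, so that each inequality
    between coefficients is proved once. Nonnegativity is asked of image pairs only: that of [D p q]
    follows from the third clause. *)
Definition contracting D K :=
  [/\ forall p, D p p = 0%E,
      forall p q, A p -> A q -> (0 <= D (K p) (K q))%E
    & forall p q, A p -> A q -> (D (K p) (K q) <= D p q)%E].

Section contracting.
Variables (D : T -> T -> \bar R) (K : T -> T).
Hypothesis hD : contracting D K.
Local Notation ec := (ergodicity_coeff A D K).

(** A pair at infinite divergence has ratio 0 because the inverse of +oo is 0, and a pair at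
    divergence 0 has an image at divergence 0; every other ratio is a quotient of reals. *)
Lemma contracting_ratio p q : A p -> A q ->
  (D (K p) (K q) / D p q = 0)%E \/
  exists d d', [/\ 0 < d, 0 <= d', D p q = d%:E, D (K p) (K q) = d'%:E
                 & (D (K p) (K q) / D p q = (d' / d)%:E)%E].
Proof.
move=> Ap Aq; have [_ /(_ p q Ap Aq) + /(_ p q Ap Aq)] := hD.
case: (D p q) => [d||]; last 2 first.
- by left; rewrite invey mule0.
- by move=> /le_trans/[apply].
case: (D (K p) (K q)) => [d'| |]; rewrite ?leye_eq ?lee_fin// => d'0 d'd.
have := le_trans d'0 d'd; rewrite le_eqVlt => /predU1P[d0|d0]; last first.
  by right; exists d, d'; rewrite inver gt_eqF.
left; have -> : d' = 0 by apply/eqP; rewrite eq_le d'0 d0 d'd.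
by rewrite mul0e.
Qed.

Lemma ergodicity_coeff_ge0 : (0 <= ec)%E.
Proof. by apply: ereal_sup_ubound; left. Qed.

Lemma ergodicity_coeff_le b : 0 <= b ->
  (forall p q d d', A p -> A q -> p <> q -> D p q = d%:E ->
     D (K p) (K q) = d'%:E -> 0 < d -> 0 <= d' -> d' <= b * d) ->
  (ec <= b%:E)%E.
Proof.
move=> b0 h; apply: ge_ereal_sup => _ [->|[p [q [Ap Aq pq ->]]]] //.
have [->//|[d [d' [d0 d'0 Dd Dd' ->]]]] := contracting_ratio Ap Aq.
by rewrite lee_fin ler_pdivrMr// (h p q).
Qed.

Lemma ergodicity_coeff_le1 : (ec <= 1)%E.
Proof.
apply: ergodicity_coeff_le => // p q d d' Ap Aq _ Dd Dd' _ _.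
by rewrite mul1r -lee_fin -Dd -Dd'; case: hD => _ _; apply.
Qed.

Lemma ergodicity_coeff_fin : ec = (fine ec)%:E.
Proof.
rewrite fineK// ge0_fin_numE ?ergodicity_coeff_ge0//.
exact: le_lt_trans ergodicity_coeff_le1 (ltry _).
Qed.

Lemma fine_ergodicity_coeff_ge0 : 0 <= fine ec.
Proof. by rewrite fine_ge0// ergodicity_coeff_ge0. Qed.

Lemma fine_ergodicity_coeff_le1 : fine ec <= 1.
Proof. by rewrite -lee_fin -ergodicity_coeff_fin ergodicity_coeff_le1. Qed.

(** Turns the supremum back into an inequality between reals, valid also for p = q and for d = 0,
    where no ratio is available. *)
Lemma ergodicity_coeff_bound p q d : A p -> A q -> D p q = d%:E ->
  exists d', [/\ D (K p) (K q) = d'%:E, 0 <= d', d' <= d & d' <= fine ec * d].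
Proof.
move=> Ap Aq Dd; have [D0 /(_ p q Ap Aq) + /(_ p q Ap Aq)] := hD.
case Dd' : (D (K p) (K q)) => [d'| |]; rewrite Dd ?leye_eq ?lee_fin// => d'0 d'd.
exists d'; split => //.
have := le_trans d'0 d'd; rewrite le_eqVlt => /predU1P[d0|d0].
  by rewrite -d0 mulr0 d0.
rewrite -ler_pdivrMr// -lee_fin -ergodicity_coeff_fin.
apply: ereal_sup_ubound; right; exists p, q; split=> //.
  by move=> pq; move: Dd; rewrite pq D0 => -[d00]; move: d0; rewrite d00 ltxx.
by rewrite Dd Dd' inver gt_eqF.
Qed.

Lemma ergodicity_coeff_lt1 p q d : A p -> A q -> D p q = d%:E -> 0 < d ->
  D (K p) (K q) = D p q -> ~ (ec < 1)%E.
Proof.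
move=> Ap Aq Dd d0 DK; have [d' []] := ergodicity_coeff_bound Ap Aq Dd.
rewrite DK Dd => -[<-] _ _; rewrite ler_pMl// => e1.
by rewrite ergodicity_coeff_fin lte_fin ltNge e1.
Qed.

Lemma ergodicity_coeff_eq0 p q : A p -> A q -> D p q != +oo%E -> ec = 0%E ->
  D (K p) (K q) = 0%E.
Proof.
move=> Ap Aq Dfin ec0.
have [_ /(_ p q Ap Aq) D'0 /(_ p q Ap Aq) D'D] := hD.
have := le_trans D'0 D'D => /gee0P[/eqP|[d d0 Dd]]; first by rewrite (negbTE Dfin).
have [d' [-> d'0 _]] := ergodicity_coeff_bound Ap Aq Dd.
by rewrite ec0 /= mul0r => d'0'; congr EFin; apply/eqP; rewrite eq_le d'0 d'0'.
Qed.

End contracting.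

Lemma ergodicity_coeff_const D K : (forall p q, A p -> A q -> K p = K q) ->
  (forall p, D p p = 0%E) -> ergodicity_coeff A D K = 0%E.
Proof.
move=> hK D0; apply/eqP; rewrite eq_le ergodicity_coeff_ge0 andbT.
apply: ge_ereal_sup => _ [->//|[p [q [Ap Aq pq ->]]]].
by rewrite (hK p q)// D0 mul0e.
Qed.

End ergodicity_coefficient.

(** * Renyi divergences as functions of D_alpha *)

Section renyi.
Variables (R : realType) (alpha : R).
Hypothesis alpha1 : alpha != 1.
Implicit Types (d e t x y : R).

Definition renyi_fun d : R := ln (1 + (alpha - 1) * d) / (alpha - 1).

Let a1N0 : alpha - 1 != 0. Proof. by rewrite subr_eq0. Qed.

Lemma lne_homo (x y : \bar R) : (x <= y)%E -> (lne x <= lne y)%E.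
Proof.
move=> xy; have [x0|x0] := leP x 0%E; first by rewrite le0_lneNy// leNye.
by rewrite lee_lne// in_itv/= leey andbT ltW// (lt_le_trans x0).
Qed.

Lemma renyi_of_EFin d : 0 < 1 + (alpha - 1) * d ->
  renyi_of alpha d%:E = (renyi_fun d)%:E.
Proof.
move=> h; rewrite /renyi_of -EFinM -EFinD lne_EFin// -EFinM.
by rewrite mulrC.
Qed.

Lemma renyi_of0 : renyi_of alpha 0 = 0%E.
Proof. by rewrite /renyi_of mule0 adde0 lne1 mule0. Qed.

Lemma lee_npmul2l r (x y : \bar R) : r <= 0 -> (x <= y)%E ->
  (r%:E * y <= r%:E * x)%E.
Proof.
move=> r0 xy; rewrite -(opprK r) EFinN !mulNe leeN2 lee_wpmul2l//.
by rewrite lee_fin oppr_ge0.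
Qed.

Lemma renyi_of_homo (x y : \bar R) : (x <= y)%E ->
  (renyi_of alpha x <= renyi_of alpha y)%E.
Proof.
move=> xy; rewrite /renyi_of.
case/orP: (lt_total alpha1) => h; last first.
  apply: lee_wpmul2l; first by rewrite lee_fin invr_ge0 subr_ge0 ltW.
  by apply/lne_homo/leeD2l/lee_wpmul2l => //; rewrite lee_fin subr_ge0 ltW.
apply: lee_npmul2l; first by rewrite invr_le0 subr_le0 ltW.
by apply/lne_homo/leeD2l/lee_npmul2l => //; rewrite subr_le0 ltW.
Qed.

(** [lne] is infinite at +oo and at every nonpositive argument, so a finite Renyi divergence comes
    from a finite D_alpha and a positive argument of the logarithm. *)
Lemma renyi_of_fin (x : \bar R) r : (0 <= x)%E -> renyi_of alpha x = r%:E ->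
  exists d, [/\ x = d%:E, 0 <= d, 0 < 1 + (alpha - 1) * d & r = renyi_fun d].
Proof.
case: x => [d| |//]; rewrite ?lee_fin => d0.
  have [h|h] := ltP 0 (1 + (alpha - 1) * d).
    by rewrite renyi_of_EFin// => -[<-]; exists d.
  rewrite /renyi_of -EFinM -EFinD le0_lneNy ?lee_fin//.
  case/orP: (lt_total a1N0) => a1; first by rewrite lt0_muleNy ?lte_fin ?invr_lt0.
  by rewrite gt0_muleNy ?lte_fin ?invr_gt0.
rewrite /renyi_of; case/orP: (lt_total a1N0) => a1.
  by rewrite lt0_muley ?lte_fin//= lt0_muleNy// lte_fin invr_lt0.
by rewrite gt0_muley ?lte_fin//= gt0_muley// lte_fin invr_gt0.
Qed.

Lemma renyi_fun_gt0 d : 0 < d -> 0 < 1 + (alpha - 1) * d -> 0 < renyi_fun d.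
Proof.
move=> d0 h; rewrite /renyi_fun; case/orP: (lt_total a1N0) => a1.
  rewrite nmulr_lgt0 ?invr_lt0// ln_lt0// h/= gtrDl.
  by rewrite nmulr_rlt0.
by rewrite divr_gt0// ln_gt0// ltrDl mulr_gt0.
Qed.

Lemma renyi_fun_le x y : 0 < 1 + (alpha - 1) * x -> 0 < 1 + (alpha - 1) * y ->
  x <= y -> renyi_fun x <= renyi_fun y.
Proof.
by move=> x0 y0; rewrite -!lee_fin -!renyi_of_EFin//; exact: renyi_of_homo.
Qed.

Lemma renyi_fun_chord t d : 1 < alpha -> 0 <= t -> t <= 1 -> 0 <= d ->
  t * renyi_fun d <= renyi_fun (t * d).
Proof.
move=> a1 t0 t1 d0; have a10 : 0 < alpha - 1 by rewrite subr_gt0.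
have h : 0 <= (alpha - 1) * d by rewrite mulr_ge0// ltW.
rewrite /renyi_fun mulrA ler_pM2r ?invr_gt0// [_ * (t * d)]mulrCA.
by rewrite ln_ge_chord//; lra.
Qed.

Lemma renyi_fun_chord_lt1 t d : alpha < 1 -> 0 <= t -> t <= 1 ->
  0 < 1 + (alpha - 1) * d -> renyi_fun (t * d) <= t * renyi_fun d.
Proof.
move=> a1 t0 t1 d0; have a10 : alpha - 1 < 0 by rewrite subr_lt0.
rewrite /renyi_fun [t * (_ / _)]mulrA ler_nM2r ?invr_lt0// [_ * (t * d)]mulrCA.
by rewrite ln_ge_chord//; lra.
Qed.

End renyi.

Section renyi_coefficient.
Variables (R : realType) (T : Type) (A : T -> Prop).
Variables (D : T -> T -> \bar R) (K : T -> T) (alpha : R).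
Hypothesis alpha1 : alpha != 1.
Hypothesis hD : contracting A D K.

Definition renyi_div p q : \bar R := renyi_of alpha (D p q).

Local Notation ecD := (ergodicity_coeff A D K).
Local Notation ecR := (ergodicity_coeff A renyi_div K).

Lemma renyi_contracting : contracting A renyi_div K.
Proof.
have [D0 D'0 D'D] := hD; split=> [p|p q Ap Aq|p q Ap Aq].
- by rewrite /renyi_div D0 renyi_of0.
- by rewrite -(renyi_of0 alpha) renyi_of_homo// D'0.
- by rewrite renyi_of_homo// D'D.
Qed.

Let D_ge0 p q : A p -> A q -> (0 <= D p q)%E.
Proof.
by have [_ D'0 D'D] := hD => Ap Aq; rewrite (le_trans (D'0 _ _ Ap Aq))// D'D.
Qed.

Lemma renyi_div_fin p q d : 1 < alpha -> 0 <= d -> D p q = d%:E ->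
  renyi_div p q = (renyi_fun alpha d)%:E.
Proof.
move=> a1 d0 Dd; rewrite /renyi_div Dd renyi_of_EFin//.
by rewrite ltr_pwDl// mulr_ge0// subr_ge0 ltW.
Qed.

Lemma ergodicity_coeff_le_renyi : 1 < alpha -> (ecD <= ecR)%E.
Proof.
move=> a1; have hR := renyi_contracting.
rewrite (ergodicity_coeff_fin hR); apply: ergodicity_coeff_le => //.
  exact: fine_ergodicity_coeff_ge0.
move=> p q d d' Ap Aq pq Dd Dd' d0 d'0.
have Rd := renyi_div_fin a1 (ltW d0) Dd.
have [r' [+ _ _]] := ergodicity_coeff_bound hR Ap Aq Rd.
rewrite (renyi_div_fin a1 d'0 Dd') => -[<-]; apply: contraTT; rewrite -!ltNge => h.
have d'd : d' <= d by rewrite -lee_fin -Dd -Dd'; have [_ _] := hD; apply.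
have rd0 : 0 < renyi_fun alpha d.
  by rewrite renyi_fun_gt0// ltr_pwDl// mulr_ge0 ?subr_ge0 ?ltW.
(* By contraposition: if d' / d exceeds the Renyi coefficient, the chord inequality makes the Renyi
   divergence of the image exceed that coefficient times [renyi_fun alpha d]. *)
apply: (@lt_le_trans _ _ (d' / d * renyi_fun alpha d)).
  by rewrite ltr_pM2r// ltr_pdivlMr.
have -> : renyi_fun alpha d' = renyi_fun alpha (d' / d * d).
  by rewrite divfK// gt_eqF.
apply: renyi_fun_chord => //; last exact: ltW.
  by rewrite divr_ge0// ltW.
by rewrite ler_pdivrMr// mul1r.
Qed.

Lemma renyi_le_ergodicity_coeff : alpha < 1 -> (ecR <= ecD)%E.
Proof.
move=> a1; have hR := renyi_contracting.
have e0 := fine_ergodicity_coeff_ge0 A D K.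
rewrite (ergodicity_coeff_fin hD); apply: ergodicity_coeff_le => //.
move=> p q r r' Ap Aq pq Rr Rr' r0 r'0.
have [d [Dd d0 h ->]] := renyi_of_fin alpha1 (D_ge0 Ap Aq) Rr.
have [d' [Dd' d'0 d'd d'e]] := ergodicity_coeff_bound hD Ap Aq Dd.
have a10 : alpha - 1 < 0 by rewrite subr_lt0.
have mono x : x <= d -> 0 < 1 + (alpha - 1) * x.
  by move=> xd; rewrite (lt_le_trans h)// lerD2l ler_nM2l.
have ed : fine ecD * d <= d.
  by rewrite ler_piMl// fine_ergodicity_coeff_le1.
have : renyi_fun alpha d' <= fine ecD * renyi_fun alpha d.
  rewrite (le_trans (renyi_fun_le _ _ _ d'e))// ?mono//.
  by rewrite renyi_fun_chord_lt1// fine_ergodicity_coeff_le1.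
by move: Rr'; rewrite /renyi_div Dd' renyi_of_EFin ?mono// => -[<-].
Qed.

(** * Bounds obtained along an extremal sequence, for orders above one *)

Section limit.
Variables (p q : nat -> T) (dlim : \bar R).
Hypotheses (alpha_gt1 : 1 < alpha) (Ap : forall k, A (p k)) (Aq : forall k, A (q k)).
Hypothesis hR : (fun k => renyi_div (K (p k)) (K (q k)) / renyi_div (p k) (q k))%E
  @ \oo --> ecR.
Hypothesis hlim : (fun k => D (p k) (q k)) @ \oo --> dlim.

Let e := fine ecD.
Let a10 : 0 < alpha - 1. Proof. by rewrite subr_gt0. Qed.
Let e0 : 0 <= e. Proof. exact: fine_ergodicity_coeff_ge0. Qed.
Let e1 : e <= 1. Proof. exact: fine_ergodicity_coeff_le1. Qed.

(** The Renyi divergence increases with D_alpha, which is at most e d on the image; the factors 1 /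
    (alpha - 1) cancel. *)
Let ratio_bound k :
  (renyi_div (K (p k)) (K (q k)) / renyi_div (p k) (q k) = 0)%E \/
  exists d, [/\ D (p k) (q k) = d%:E, 0 < d
  & (renyi_div (K (p k)) (K (q k)) / renyi_div (p k) (q k) <=
     (ln (1 + (alpha - 1) * (e * d)) / ln (1 + (alpha - 1) * d))%:E)%E].
Proof.
have [->|[r [r' [r0 r'0 Rr Rr' ->]]]] :=
  contracting_ratio renyi_contracting (Ap k) (Aq k); first by left.
right; have [d [Dd d0 h rE]] := renyi_of_fin alpha1 (D_ge0 (Ap k) (Aq k)) Rr.
have [d' [Dd' d'0 _ d'e]] := ergodicity_coeff_bound hD (Ap k) (Aq k) Dd.
exists d; split => //.
  rewrite lt_neqAle d0 andbT; apply/eqP => d00; move: r0.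
  by rewrite rE -d00 /renyi_fun mulr0 addr0 ln1 mul0r ltxx.
have r'E : r' = renyi_fun alpha d'.
  by move: Rr'; rewrite (renyi_div_fin _ d'0 Dd')// => -[].
have lnd : 0 < ln (1 + (alpha - 1) * d).
  by move: r0; rewrite rE /renyi_fun pmulr_lgt0// invr_gt0.
rewrite lee_fin rE r'E /renyi_fun.
rewrite [leLHS](_ : _ = ln (1 + (alpha - 1) * d') / ln (1 + (alpha - 1) * d)); last first.
  by rewrite invfM invrK mulrACA mulVf ?mulr1// gt_eqF.
rewrite ler_pM2r ?invr_gt0// ler_ln ?posrE.
- by rewrite lerD2l ler_pM2l.
- by rewrite ltr_pwDl// mulr_ge0// ltW.
- by rewrite ltr_pwDl// mulr_ge0 ?mulr_ge0// ltW.
Qed.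

(** For a finite positive limit, the bound of [ratio_bound] is continuous there and passes to the
    limit. At +oo, either the D_alpha coefficient is 0 and all ratios vanish, or the bound is the
    trivial one, 1. *)
Lemma renyi_coeff_le_log_ratio : (0 < dlim)%E ->
  (ecR <= log_ratio alpha ecD dlim)%E /\ (log_ratio alpha ecD dlim <= 1)%E.
Proof.
have ecDE := ergodicity_coeff_fin hD; rewrite -/e in ecDE.
rewrite /log_ratio; case: eqP => [_ _|/eqP dfin d0].
  have [ec0|ecN0] := eqVneq ecD 0%E; last first.
    by rewrite ergodicity_coeff_le1//; exact: renyi_contracting.
  split; rewrite ?lee01//; apply: cvge_le hR; apply: nearW => k.
  have [-> //|[d [_ _]]] := ratio_bound k.
  by rewrite /e ec0 /= mul0r mulr0 addr0 ln1 mul0r.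
have [d dE] : exists d, dlim = d%:E.
  by move: dlim d0 dfin => [d _ _||]//; exists d.
move: (hlim); rewrite dE => hlim'; rewrite dE lte_fin in d0.
have pos x : 0 < x -> 0 < (alpha - 1) * x by exact: mulr_gt0.
have lnd x : 0 < x -> 0 < ln (1 + (alpha - 1) * x).
  by move=> /pos h; rewrite ln_gt0// ltrDl.
have ed0 : 0 < 1 + (alpha - 1) * (e * d).
  by rewrite ltr_pwDl// mulr_ge0 ?mulr_ge0// ltW.
rewrite ecDE -!EFinM -!EFinD -mulrA !lne_EFin//; last first.
  by rewrite addr_gt0// pos.
rewrite inver gt_eqF ?lnd// -EFinM; split; last first.
  rewrite lee_fin ler_pdivrMr ?lnd// mul1r ler_ln ?posrE//; last by rewrite addr_gt0// pos.
  by rewrite lerD2l ler_pM2l// ler_piMl// ltW.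
have /fine_cvgP[Dfin Dd] := hlim'.
pose g (x : R) := ln (1 + (alpha - 1) * (e * x)) / ln (1 + (alpha - 1) * x).
have gcvg : (g (fine (D (p k) (q k))))%:E @[k --> \oo] --> (g d)%:E.
  apply: cvg_EFin; first exact: nearW.
  have c1 : (1 + (alpha - 1) * (e * fine (D (p k) (q k)))) @[k --> \oo]
      --> 1 + (alpha - 1) * (e * d).
    by apply: cvgD; [exact: cvg_cst|apply: cvgMr; exact: cvgMr].
  have c2 : (1 + (alpha - 1) * fine (D (p k) (q k))) @[k --> \oo]
      --> 1 + (alpha - 1) * d.
    by apply: cvgD; [exact: cvg_cst|exact: cvgMr].
  apply: cvgM.
    by apply: (continuous_cvg _ _ c1); exact: continuous_ln.
  apply: cvgV; first by rewrite gt_eqF// lnd.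
  apply: (continuous_cvg _ _ c2); apply: continuous_ln.
  by rewrite addr_gt0// pos.
apply: lee_cvg_to hR gcvg _; near=> k.
have Dge0 : 0 <= fine (D (p k) (q k)) by rewrite fine_ge0// D_ge0.
have [->|[x [Dx x0]]] := ratio_bound k; last by rewrite Dx.
rewrite lee_fin /g divr_ge0// ln_ge0// lerDl ?mulr_ge0// ltW//.
Unshelve. all: by end_near. Qed.

(** The logarithmic bound has the form 0/0 at d = 0. With y = (alpha - 1) d, the inequalities y / (1
    + y) <= ln(1 + y) <= y replace it by e (1 + y), which tends to e. *)
Lemma renyi_coeff_le_at_diag : dlim = 0%E -> (ecR <= ecD)%E.
Proof.
move=> d0; move: (hlim); rewrite d0 => /fine_cvgP[Dfin Dd].
have gcvg : (e * (1 + (alpha - 1) * fine (D (p k) (q k))))%:E @[k --> \oo]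
    --> e%:E.
  apply: cvg_EFin; first exact: nearW.
  rewrite -[X in _ --> X](_ : e * (1 + (alpha - 1) * 0) = e); last by ring.
  by apply: cvgMr; apply: cvgD; [exact: cvg_cst|exact: cvgMr].
rewrite (ergodicity_coeff_fin hD) -/e.
apply: lee_cvg_to hR gcvg _; apply: nearW => k.
have Dge0 : 0 <= fine (D (p k) (q k)) by rewrite fine_ge0// D_ge0.
have [->|[x [Dx x0]]] := ratio_bound k.
  by rewrite lee_fin mulr_ge0// addr_ge0// mulr_ge0// ltW.
rewrite Dx/= => /le_trans; apply; rewrite lee_fin.
set y := (alpha - 1) * x; have y0 : 0 < y by rewrite mulr_gt0.
have -> : (alpha - 1) * (e * x) = e * y by rewrite /y; ring.
have ly : 0 < ln (1 + y) by rewrite ln_gt0// ltrDl.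
rewrite ler_pdivrMr// -mulrA.
apply: (@le_trans _ _ (e * y)).
  by rewrite le_ln1Dx// (lt_le_trans (ltrN10 _))// mulr_ge0// ltW.
rewrite ler_wpM2l//.
have y1 : 0 < 1 + y by rewrite addr_gt0.
(* The lower bound on ln(1 + y) is ln(1 + s) <= s at s = - y / (1 + y). *)
have : ln (1 + y)^-1 <= - y / (1 + y).
  rewrite [X in ln X](_ : _ = 1 + (- y / (1 + y))); last by field; rewrite gt_eqF.
  apply: le_ln1Dx; rewrite ltr_pdivlMr//; lra.
rewrite lnV ?posrE// mulNr lerN2 ler_pdivrMr// mulrC; exact.
Qed.

End limit.
End renyi_coefficient.

(** * Comparison and composition of ergodicity coefficients *)

Section coefficient_comparison.
Variables (R : realType) (T : Type) (A : T -> Prop).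
Implicit Types (D : T -> T -> \bar R) (K : T -> T).

Lemma ergodicity_coeff_embed (T' : Type) (A' : T' -> Prop) D
    (D' : T' -> T' -> \bar R) K (K' : T' -> T') (i : T -> T') :
  (forall p, A p -> A' (i p)) -> injective i ->
  (forall p q, D' (i p) (i q) = D p q) ->
  (forall p, K' (i p) = i (K p)) ->
  (ergodicity_coeff A D K <= ergodicity_coeff A' D' K')%E.
Proof.
move=> hA hi hD hK; apply: ereal_sup_le => _ [->|[p [q [Ap Aq pq ->]]]]; first by left.
right; exists (i p), (i q); split; rewrite ?hK ?hD//; try exact: hA.
by move/hi.
Qed.

Lemma ergodicity_coeff_swap D K :
  ergodicity_coeff A (fun p q => D q p) K = ergodicity_coeff A D K.
Proof.
congr ereal_sup; congr setU; apply/seteqP.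
by split=> r [p [q [Ap Aq pq ->]]]; exists q, p; split => // /esym.
Qed.

Lemma ergodicity_coeff_convex D K1 K2 K3 (t : R) : 0 <= t -> t <= 1 ->
  contracting A D K1 -> contracting A D K2 -> contracting A D K3 ->
  (forall p q d1 d2, A p -> A q -> D (K1 p) (K1 q) = d1%:E ->
     D (K2 p) (K2 q) = d2%:E ->
     (D (K3 p) (K3 q) <= (t * d1 + (1 - t) * d2)%:E)%E) ->
  (ergodicity_coeff A D K3 <=
    t%:E * ergodicity_coeff A D K1 + (1 - t)%:E * ergodicity_coeff A D K2)%E.
Proof.
move=> t0 t1 h1 h2 h3 H.
rewrite (ergodicity_coeff_fin h1) (ergodicity_coeff_fin h2) -!EFinM -EFinD.
have e1 := fine_ergodicity_coeff_ge0 A D K1.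
have e2 := fine_ergodicity_coeff_ge0 A D K2.
have t1' : 0 <= 1 - t by lra.
apply: ergodicity_coeff_le => //; first by rewrite addr_ge0// mulr_ge0.
move=> p q d d3 Ap Aq _ Dd Dd3 d0 _.
have [d1 [Dd1 _ _ d1e]] := ergodicity_coeff_bound h1 Ap Aq Dd.
have [d2 [Dd2 _ _ d2e]] := ergodicity_coeff_bound h2 Ap Aq Dd.
have := H p q d1 d2 Ap Aq Dd1 Dd2; rewrite Dd3 lee_fin => /le_trans; apply.
by rewrite [leRHS]mulrDl -!mulrA lerD// ler_wpM2l.
Qed.

Lemma ergodicity_coeff_comp D K1 K2 : (forall p, A p -> A (K1 p)) ->
  contracting A D K1 -> contracting A D K2 -> contracting A D (K2 \o K1) ->
  (ergodicity_coeff A D (K2 \o K1) <=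
    ergodicity_coeff A D K1 * ergodicity_coeff A D K2)%E.
Proof.
move=> AK h1 h2 h3.
rewrite (ergodicity_coeff_fin h1) (ergodicity_coeff_fin h2) -EFinM.
have e1 := fine_ergodicity_coeff_ge0 A D K1.
have e2 := fine_ergodicity_coeff_ge0 A D K2.
apply: ergodicity_coeff_le => //; first by rewrite mulr_ge0.
move=> p q d d2 Ap Aq _ Dd Dd2 d0 _.
have [d1 [Dd1 _ _ d1e]] := ergodicity_coeff_bound h1 Ap Aq Dd.
have [d2' [+ _ _ d2e]] := ergodicity_coeff_bound h2 (AK _ Ap) (AK _ Aq) Dd1.
rewrite [X in X = _ -> _]Dd2 => -[->]; apply: (le_trans d2e).
by rewrite mulrAC [leRHS]mulrC ler_wpM2l.
Qed.

(** The upper comparison is used on the image pair and the lower one on the original pair, hence the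
    factor c2 / c1. *)
Lemma ergodicity_coeff_compare D1 D2 K (c1 c2 : R) : 0 < c1 -> 0 < c2 ->
  (forall p, A p -> A (K p)) -> contracting A D1 K -> contracting A D2 K ->
  (forall p q, A p -> A q -> (c1%:E * D2 p q <= D1 p q)%E) ->
  (forall p q, A p -> A q -> (D1 p q <= c2%:E * D2 p q)%E) ->
  (ergodicity_coeff A D1 K <= (c2 / c1)%:E * ergodicity_coeff A D2 K)%E.
Proof.
move=> c10 c20 AK h1 h2 H1 H2.
have e0 := fine_ergodicity_coeff_ge0 A D2 K.
rewrite (ergodicity_coeff_fin h2) -EFinM.
apply: ergodicity_coeff_le => //; first by rewrite mulr_ge0// divr_ge0// ltW.
move=> p q d d' Ap Aq _ Dd Dd' d0 _.
have := H1 _ _ Ap Aq; rewrite Dd.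
have [_ D2'0 D2'D2] := h2.
have := le_trans (D2'0 _ _ Ap Aq) (D2'D2 _ _ Ap Aq).
case D2d : (D2 p q) => [d2| |]//; last by rewrite gt0_muley ?lte_fin// leye_eq.
rewrite -EFinM !lee_fin => d20 cd.
have [d2' [D2d' _ _ d2'e]] := ergodicity_coeff_bound h2 Ap Aq D2d.
have := H2 _ _ (AK _ Ap) (AK _ Aq); rewrite Dd' D2d' -EFinM lee_fin => /le_trans; apply.
apply: (@le_trans _ _ (c2 * (fine (ergodicity_coeff A D2 K) * d2))).
  by rewrite ler_pM2l.
rewrite -!mulrA ler_pM2l// mulrA [c1^-1 * _]mulrC -mulrA ler_wpM2l//.
by rewrite mulrC ler_pdivlMr// mulrC.
Qed.

End coefficient_comparison.

(** * Divergences between transition matrices *)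

Section divergence_on_transitions.
Variables (R : realType) (n : nat) (pi : 'rV[R]_n).
Hypotheses (hpi : is_pmf pi) (hpi0 : forall x, 0 < pi 0 x).
Implicit Types (f : R -> R) (M L P Q : 'M[R]_n) (mu nu : 'rV[R]_n).

Lemma overlap_le1 P x y : is_transition P ->
  1 - \sum_z Num.min (P x z) (P y z) <= 1.
Proof.
by move=> hP; rewrite gerBl sumr_ge0// => z _; rewrite le_min !transition_ge0.
Qed.

Lemma fdivt_contracting f P : convex_on_nonneg f -> f 1 = 0 ->
  is_transition P -> contracting (@is_pmf R n) (fdivt f) (fun mu => mu *m P).
Proof.
move=> cf f1 hP; split=> [mu|mu nu hmu hnu|mu nu hmu hnu].
- exact: fdivtxx.
- by apply: fdivt_ge0 => //; exact: pmf_mulmx.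
case E : (fdivt f mu nu) => [d| |]; rewrite ?leey//; last first.
  by have := fdivt_ge0 cf f1 hmu hnu; rewrite E.
rewrite -[d]mul1r; apply: (fdivt_contraction cf f1 hP _ hmu hnu E).
by move=> x y _; exact: overlap_le1.
Qed.

Lemma fdivxx f M : f 1 = 0 -> fdiv pi f M M = 0%E.
Proof.
by move=> f1; rewrite /fdiv big1// => x _; rewrite fdivtxx// mule0.
Qed.

Lemma fdiv_ge0 f M L : convex_on_nonneg f -> f 1 = 0 ->
  is_transition M -> is_transition L -> (0 <= fdiv pi f M L)%E.
Proof.
move=> cf f1 hM hL; apply: sume_ge0 => x _; rewrite mule_ge0 ?fdivt_ge0//.
by rewrite lee_fin ltW.
Qed.

Lemma fdiv_contracting f P : convex_on_nonneg f -> f 1 = 0 ->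
  is_transition P ->
  contracting (@is_transition R n) (fdiv pi f) (fun M => M *m P).
Proof.
move=> cf f1 hP; split=> [M|M L hM hL|M L hM hL].
- exact: fdivxx.
- by apply: fdiv_ge0 => //; exact: transition_mulmx.
apply: lee_sum => x _; apply: lee_wpmul2l; first by rewrite lee_fin ltW.
by rewrite !row_mul; have [_ _] := fdivt_contracting cf f1 hP; apply.
Qed.

(** As [pi] charges every state, one row at infinite divergence would make the average infinite. *)
Lemma fdiv_rows_fin f M L d : convex_on_nonneg f -> f 1 = 0 ->
  is_transition M -> is_transition L -> fdiv pi f M L = d%:E ->
  exists v : 'I_n -> R, (forall x, fdivt f (row x M) (row x L) = (v x)%:E) /\
    d = \sum_x pi 0 x * v x.
Proof.
move=> cf f1 hM hL Dd.
have rowfin x : fdivt f (row x M) (row x L) \is a fin_num.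
  have : fdiv pi f M L \is a fin_num by rewrite Dd.
  move=> /sum_fin_numP/(_ x (mem_index_enum _) isT).
  have := fdivt_ge0 cf f1 (hM x) (hL x).
  by case: fdivt => // _; rewrite gt0_muley// lte_fin.
exists (fun x => fine (fdivt f (row x M) (row x L))); split=> [x|].
  by rewrite fineK.
apply: EFin_inj; rewrite -Dd -sumEFin; apply: eq_bigr => x _.
by rewrite EFinM fineK.
Qed.

Lemma fdiv_rowsE f M L (v : 'I_n -> R) :
  (forall x, fdivt f (row x M) (row x L) = (v x)%:E) ->
  fdiv pi f M L = (\sum_x pi 0 x * v x)%:E.
Proof. by move=> h; rewrite -sumEFin; apply: eq_bigr => x _; rewrite h EFinM. Qed.

Definition cst_rows mu : 'M[R]_n := \matrix_(x < n, y < n) mu 0 y.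

Lemma row_cst_rows mu x : row x (cst_rows mu) = mu.
Proof. by apply/rowP => y; rewrite !mxE. Qed.

Lemma state_inhabited : inhabited 'I_n.
Proof.
apply: contrapT => h; have [_] := hpi; rewrite big1 => [/esym/eqP|x].
  by rewrite oner_eq0.
by case: h; exists.
Qed.

Lemma cst_rows_inj : injective cst_rows.
Proof.
move=> mu nu h; have [x] := state_inhabited.
by rewrite -(row_cst_rows mu x) h row_cst_rows.
Qed.

Lemma fdiv_cst_rows f mu nu :
  fdiv pi f (cst_rows mu) (cst_rows nu) = fdivt f mu nu.
Proof.
rewrite /fdiv; under eq_bigr do rewrite !row_cst_rows.
rewrite -ge0_sume_distrl; last by move=> x _; rewrite lee_fin ltW.
by rewrite sumEFin; case: hpi => _ ->; rewrite mul1e.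
Qed.

Lemma cst_rows_mulmx mu P : cst_rows mu *m P = cst_rows (mu *m P).
Proof. by apply/row_matrixP => x; rewrite row_mul !row_cst_rows. Qed.

(** Laws embed isometrically as matrices with constant rows. Conversely the divergence of two
    matrices is a [pi]-average over rows, and each row contracts at the rate [etat f P]. *)
Lemma eta_etat f P : convex_on_nonneg f -> f 1 = 0 -> is_transition P ->
  eta pi f P = etat f P.
Proof.
move=> cf f1 hP; have ht := fdivt_contracting cf f1 hP.
apply/eqP; rewrite eq_le; apply/andP; split; last first.
  apply: (ergodicity_coeff_embed (@transition_cst R n) cst_rows_inj).
    by move=> mu nu; exact: fdiv_cst_rows.
  by move=> mu; exact: cst_rows_mulmx.
rewrite /etat (ergodicity_coeff_fin ht).
apply: (ergodicity_coeff_le (fdiv_contracting cf f1 hP)).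
  exact: fine_ergodicity_coeff_ge0.
move=> M L d d' hM hL _ Dd Dd' d0 d'0.
have [v [vE ->]] := fdiv_rows_fin cf f1 hM hL Dd.
have [v' [v'E ->]] := fdiv_rows_fin cf f1 (transition_mulmx hM hP)
  (transition_mulmx hL hP) Dd'.
rewrite mulr_sumr; apply: ler_sum => x _; rewrite mulrCA ler_pM2l//.
have [w [+ _ _ we]] := ergodicity_coeff_bound ht (hM x) (hL x) (vE x).
by rewrite -!row_mul v'E => -[->].
Qed.

(** Only the embedding carries over to Renyi divergences, since the logarithm is taken after the
    average over rows. *)
Lemma etatR_le_etaR (alpha : R) P : (etatR alpha P <= etaR pi alpha P)%E.
Proof.
apply: (ergodicity_coeff_embed (@transition_cst R n) cst_rows_inj).
  by move=> mu nu; rewrite /renyi fdiv_cst_rows.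
by move=> mu; exact: cst_rows_mulmx.
Qed.

Lemma fdivt_convex f mu1 mu2 nu1 nu2 (t d1 d2 : R) :
  convex_on_nonneg f -> f 1 = 0 -> 0 <= t -> t <= 1 ->
  is_pmf mu1 -> is_pmf mu2 -> is_pmf nu1 -> is_pmf nu2 ->
  fdivt f mu1 nu1 = d1%:E -> fdivt f mu2 nu2 = d2%:E ->
  (fdivt f (t *: mu1 + (1 - t) *: mu2) (t *: nu1 + (1 - t) *: nu2)
    <= (t * d1 + (1 - t) * d2)%:E)%E.
Proof.
move=> cf f1 t0 t1 hmu1 hmu2 hnu1 hnu2 D1 D2.
have t1' : 0 <= 1 - t by lra.
have fin1 x := @fdiv_term_fin R n f cf mu1 nu1 x hmu1 hnu1.
have fin2 x := @fdiv_term_fin R n f cf mu2 nu2 x hmu2 hnu2.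
rewrite D1 in fin1; rewrite D2 in fin2.
rewrite EFinD !EFinM -D1 -D2 /fdivt.
rewrite !fin_num_sume_distrr//; last 2 first.
- by move=> x y _ _; rewrite fin_num_adde_defl// fin2.
- by move=> x y _ _; rewrite fin_num_adde_defl// fin1.
rewrite -big_split; apply: lee_sum => x _; rewrite !mxE/= -!fdiv_termZ//.
by apply: fdiv_termD; rewrite ?mulr_ge0 ?pmf_ge0.
Qed.

Lemma fdiv_convex f M L P1 P2 (t d1 d2 : R) :
  convex_on_nonneg f -> f 1 = 0 -> 0 <= t -> t <= 1 ->
  is_transition M -> is_transition L -> is_transition P1 -> is_transition P2 ->
  fdiv pi f (M *m P1) (L *m P1) = d1%:E ->
  fdiv pi f (M *m P2) (L *m P2) = d2%:E ->
  (fdiv pi f (M *m (t *: P1 + (1 - t) *: P2)) (L *m (t *: P1 + (1 - t) *: P2))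
    <= (t * d1 + (1 - t) * d2)%:E)%E.
Proof.
move=> cf f1 t0 t1 hM hL hP1 hP2 D1 D2.
have hMP1 := transition_mulmx hM hP1; have hLP1 := transition_mulmx hL hP1.
have hMP2 := transition_mulmx hM hP2; have hLP2 := transition_mulmx hL hP2.
have [v1 [v1E ->]] := fdiv_rows_fin cf f1 hMP1 hLP1 D1.
have [v2 [v2E ->]] := fdiv_rows_fin cf f1 hMP2 hLP2 D2.
rewrite !mulr_sumr -big_split -sumEFin; apply: lee_sum => x _ /=.
rewrite ![_ * (pi _ _ * _)]mulrCA -mulrDr EFinM.
apply: lee_wpmul2l; first by rewrite lee_fin ltW.
rewrite !mulmxDr -!scalemxAr !linearD/= !linearZ/=.
by apply: fdivt_convex.
Qed.

End divergence_on_transitions.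

(** * Divergences of order less than one *)

Section hellinger.
Variables (R : realType) (n : nat) (pi : 'rV[R]_n).
Hypotheses (hpi : is_pmf pi) (hpi0 : forall x, 0 < pi 0 x).
Implicit Types (M L P : 'M[R]_n) (mu nu : 'rV[R]_n) (a b : R).

(** t^a grows more slowly than t, so zeros of the second law cost nothing at infinity and D_a is
    always finite. *)
Lemma recession_alpha_gen a : 0 < a -> a < 1 -> recession (alpha_gen a) = 0%E.
Proof.
move=> a0 a1; apply/cvg_lim => //.
have h : ((u `^ (1 - a) - u) / (a - 1))%:E @[u --> (0 : R)^'+] --> 0%E.
  apply: cvg_EFin; first exact: nearW.
  rewrite -[X in _ --> X](_ : (0 - 0) / (a - 1) = 0); last by rewrite subrr mul0r.
  apply: cvgMl; apply: cvgB; first by apply: powR_cvg0; rewrite subr_gt0.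
  by apply: cvg_at_right_filter; exact: cvg_id.
apply: cvg_trans h; apply: near_eq_cvg; near=> u.
have u0 : 0 < u by near: u; exact: nbhs_right_gt.
congr EFin; rewrite /alpha_gen mulrA mulrBr mulr1; congr ((_ - _) / _).
rewrite -powR_inv1 ?ltW// -powRrM mulN1r -{2}(powRr1 (ltW u0)) -powRD//.
by apply/implyP => _; rewrite gt_eqF.
Unshelve. all: by end_near. Qed.

Lemma fdiv_term_alpha_gen a m l : 0 < a -> a < 1 -> 0 <= m -> 0 <= l ->
  fdiv_term (alpha_gen a) m l = ((l - m `^ a * l `^ (1 - a)) / (1 - a))%:E.
Proof.
move=> a0 a1 m0 l0; have [->|lN0] := eqVneq l 0.
  rewrite fdiv_term0 recession_alpha_gen// mule0 powR0 ?subr_eq0 ?gt_eqF//.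
  by rewrite mulr0 subrr mul0r.
rewrite fdiv_term_neq0//; congr EFin; rewrite /alpha_gen.
have l_gt0 : 0 < l by rewrite lt_neqAle eq_sym lN0.
rewrite powRM// ?invr_ge0//.
have -> : l `^ (1 - a) = l * l^-1 `^ a.
  rewrite -[l^-1]powR_inv1// -powRrM mulN1r -{2}(powRr1 l0) -powRD//.
  by rewrite lN0 implybT.
have a10 : a - 1 != 0 by rewrite subr_eq0 lt_eqF.
have a01 : 1 - a != 0 by rewrite subr_eq0 gt_eqF.
by field; rewrite a10 a01.
Qed.

Definition hellinger a M L : R :=
  \sum_x pi 0 x * \sum_y (M x y `^ a * L x y `^ (1 - a)).

Lemma hellinger_swap a M L : hellinger (1 - a) L M = hellinger a M L.
Proof.
apply: eq_bigr => x _; congr (_ * _); apply: eq_bigr => y _.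
by rewrite mulrC opprB addrC subrK.
Qed.

Lemma hellinger_ge0 a M L : 0 <= hellinger a M L.
Proof.
apply: sumr_ge0 => x _; rewrite mulr_ge0 ?(ltW (hpi0 x))// sumr_ge0// => y _.
by rewrite mulr_ge0// powR_ge0.
Qed.

Lemma fdiv_hellinger a M L : 0 < a -> a < 1 ->
  is_transition M -> is_transition L ->
  fdiv pi (alpha_gen a) M L = ((1 - hellinger a M L) / (1 - a))%:E.
Proof.
move=> a0 a1 hM hL.
rewrite (fdiv_rowsE pi (v := fun x =>
  (1 - \sum_y (M x y `^ a * L x y `^ (1 - a))) / (1 - a))) => [|x].
  congr EFin; under eq_bigr do rewrite mulrA mulrBr mulr1.
  by rewrite -mulr_suml sumrB; case: hpi => _ ->.
rewrite -[X in X - \sum__ _](transition_sum x hL) -sumrB mulr_suml -sumEFin.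
by apply: eq_bigr => y _; rewrite !mxE fdiv_term_alpha_gen ?transition_ge0.
Qed.

Lemma renyi_hellinger a M L : 0 < a -> a < 1 ->
  is_transition M -> is_transition L ->
  renyi pi a M L = if hellinger a M L == 0 then +oo%E
                   else (- ln (hellinger a M L) / (1 - a))%:E.
Proof.
move=> a0 a1 hM hL; rewrite /renyi /renyi_of fdiv_hellinger// -EFinM -EFinD.
have a01 : 1 - a != 0 by rewrite subr_eq0 gt_eqF.
have -> : 1 + (a - 1) * ((1 - hellinger a M L) / (1 - a)) = hellinger a M L.
  by field.
case: eqP => [->|/eqP h0].
  by rewrite le0_lneNy// lt0_muleNy// lte_fin invr_lt0 subr_lt0.
rewrite lne_EFin ?lt_neqAle 1?eq_sym ?h0 ?hellinger_ge0// -EFinM; congr EFin.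
by rewrite mulrC mulNr -mulrN -invrN opprB.
Qed.

(** Hoelder's inequality with weights 1 - s and s: a term of order b is M^(1 - s) (M^a L^(1 - a))^s.
    After division by the integral V of order a, Young's inequality is applied term by term, and
    both averaged families have total mass 1. *)
Lemma hellinger_le_powR a b M L : 0 < a -> a < b -> b < 1 ->
  is_transition M -> is_transition L ->
  hellinger b M L <= hellinger a M L `^ ((1 - b) / (1 - a)).
Proof.
move=> a0 ab b1 hM hL; set s := (1 - b) / (1 - a).
have a1 : a < 1 by exact: lt_trans b1.
have a01 : 0 < 1 - a by rewrite subr_gt0.
have b01 : 0 < 1 - b by rewrite subr_gt0.
have s0 : 0 < s by rewrite divr_gt0.
have s1 : s < 1 by rewrite ltr_pdivrMr// mul1r; lra.
have bE : b = 1 - s + a * s by rewrite /s; field; rewrite gt_eqF.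
have b1E : 1 - b = (1 - a) * s by rewrite /s mulrC divfK// gt_eqF.
have b0 : 0 < b by exact: lt_trans ab.
have M0 x y : 0 <= M x y by exact: transition_ge0.
have L0 x y : 0 <= L x y by exact: transition_ge0.
have termE x y : M x y `^ b * L x y `^ (1 - b) =
    M x y `^ (1 - s) * (M x y `^ a * L x y `^ (1 - a)) `^ s.
  rewrite powRM ?powR_ge0// -!powRrM mulrA -b1E; congr (_ * _).
  have [->|mN0] := eqVneq (M x y) 0.
    rewrite (powR0 (lt0r_neq0 b0)) powR0 ?mul0r// subr_eq0 gt_eqF//.
  by rewrite -powRD ?mN0 ?implybT// -bE.
have [V0|VN0] := eqVneq (hellinger a M L) 0.
  suff -> : hellinger b M L = 0 by rewrite powR_ge0.
  apply: big1 => x _; rewrite big1 ?mulr0// => y _; rewrite termE.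
  suff -> : M x y `^ a * L x y `^ (1 - a) = 0 by rewrite powR0 ?mulr0// gt_eqF.
  move/eqP: V0; rewrite psumr_eq0; last first.
    move=> z _; rewrite mulr_ge0 ?(ltW (hpi0 z))// sumr_ge0// => w _.
    by rewrite mulr_ge0// powR_ge0.
  move=> /allP/(_ x (mem_index_enum _)); rewrite mulf_eq0 gt_eqF//= psumr_eq0.
    by move=> /allP/(_ y (mem_index_enum _))/eqP.
  by move=> w _; rewrite mulr_ge0// powR_ge0.
set V := hellinger a M L in VN0 *.
have V0 : 0 < V by rewrite lt_neqAle eq_sym VN0 hellinger_ge0.
rewrite -[leRHS]mul1r -ler_pdivrMr ?powR_gt0//.
have -> : hellinger b M L / V `^ s = \sum_x pi 0 x * \sum_y
    (M x y `^ (1 - s) * (M x y `^ a * L x y `^ (1 - a) / V) `^ s).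
  rewrite mulr_suml; apply: eq_bigr => x _; rewrite -mulrA mulr_suml.
  congr (_ * _); apply: eq_bigr => y _.
  rewrite termE -mulrA; congr (_ * _).
  rewrite [RHS]powRM ?invr_ge0 ?(ltW V0) ?mulr_ge0 ?powR_ge0//; congr (_ * _).
  by rewrite -[V^-1]powR_inv1 ?ltW// -powRrM mulN1r powRN.
apply: (@le_trans _ _ (\sum_x pi 0 x * \sum_y
    ((1 - s) * M x y + s * (M x y `^ a * L x y `^ (1 - a) / V)))).
  apply: ler_sum => x _; rewrite ler_pM2l//; apply: ler_sum => y _.
  by apply: powR_young => //; rewrite divr_ge0 ?(ltW V0)// mulr_ge0// powR_ge0.
under eq_bigr do rewrite big_split/= -!mulr_sumr -mulr_suml transition_sum// mulrDr mulr1.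
rewrite big_split/= -mulr_suml; case: hpi => _ ->; rewrite mul1r.
have -> : \sum_x pi 0 x * (s * ((\sum_y M x y `^ a * L x y `^ (1 - a)) / V)) =
   s * (V / V).
  rewrite {2}/V /hellinger mulr_suml mulr_sumr; apply: eq_bigr => x _.
  by ring.
by rewrite divff//; lra.
Qed.

Lemma renyi_le_order a b M L : 0 < a -> a < b -> b < 1 ->
  is_transition M -> is_transition L ->
  (renyi pi a M L <= renyi pi b M L)%E.
Proof.
move=> a0 ab b1 hM hL; have a1 : a < 1 by exact: lt_trans b1.
have b0 : 0 < b by exact: lt_trans ab.
rewrite !renyi_hellinger//; have := hellinger_le_powR a0 ab b1 hM hL.
have [->|Hb0] := eqVneq (hellinger b M L) 0; first by rewrite leey.
have Hb : 0 < hellinger b M L by rewrite lt_neqAle eq_sym Hb0 hellinger_ge0.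
have a01 : 0 < 1 - a by rewrite subr_gt0.
have b01 : 0 < 1 - b by rewrite subr_gt0.
have [->|Ha0] := eqVneq (hellinger a M L) 0.
  rewrite powR0; first by rewrite leNgt Hb.
  by rewrite mulf_neq0 ?invr_eq0 ?gt_eqF.
have Ha : 0 < hellinger a M L by rewrite lt_neqAle eq_sym Ha0 hellinger_ge0.
rewrite -ler_ln ?posrE ?powR_gt0// ln_powR lee_fin => h.
rewrite !mulNr lerN2 ler_pdivrMr//; apply: (le_trans h).
by rewrite mulrC mulrA mulrAC.
Qed.

Lemma renyi_swap a M L : 0 < a -> a < 1 -> is_transition M -> is_transition L ->
  renyi pi a M L = ((a / (1 - a))%:E * renyi pi (1 - a) L M)%E.
Proof.
move=> a0 a1 hM hL; have a01 : 0 < 1 - a by rewrite subr_gt0.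
rewrite !renyi_hellinger ?gtrBl ?subr_gt0// hellinger_swap.
have -> : 1 - (1 - a) = a by ring.
case: eqP => _; first by rewrite gt0_muley// lte_fin divr_gt0.
by rewrite -EFinM; congr EFin; field; rewrite !gt_eqF.
Qed.

End hellinger.

(** For y <= B the constant [k] ensures (1 + y) (1 + k y) <= 1 + y / e' <= 1 + x, while the left
    side is at least (1 + y)^(1 + k) by concavity of the logarithm; hence b = 1 / (1 + k).
    Boundedness of y is what keeps [k] away from 0. *)
Lemma log_contraction (R : realType) (e B : R) : 0 <= e -> e < 1 -> 0 <= B ->
  exists2 b, 0 <= b < 1 & forall x y : R, 0 <= x -> 0 <= y -> y <= e * x -> y <= B ->
    ln (1 + y) <= b * ln (1 + x).
Proof.
(* The midpoint of e and 1 is invertible even when e = 0, and being at least 1/2 it gives k <= 1. *)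
move=> e0 e1 B0; pose e' := (1 + e) / 2.
have e'0 : 0 < e' by rewrite /e'; lra.
have e'1 : e' < 1 by rewrite /e'; lra.
pose k := (e'^-1 - 1) / (1 + B).
have B1 : 0 < 1 + B by lra.
have e'V : 1 < e'^-1 by rewrite invf_gt1.
have k0 : 0 < k by rewrite divr_gt0// subr_gt0.
have k1 : k <= 1.
  rewrite ler_pdivrMr// mul1r; apply: (@le_trans _ _ 1); last by lra.
  by rewrite lerBlDr -[e'^-1]mul1r ler_pdivrMr// /e'; lra.
exists (1 + k)^-1.
  by rewrite invr_ge0 invf_lt1//; lra.
move=> x y x0 y0 yex yB; rewrite mulrC ler_pdivlMr; last by lra.
have y1 : 0 < 1 + y by lra.
have ky : 0 < 1 + k * y by rewrite ltr_pwDl// mulr_ge0// ltW.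
apply: (@le_trans _ _ (ln (1 + y) + ln (1 + k * y))).
  rewrite mulrDr mulr1 lerD2l mulrC ln_ge_chord//; first exact: ltW.
  by lra.
rewrite -lnM ?posrE//.
have prod_le : (1 + y) * (1 + k * y) <= 1 + y / e'.
  have -> : 1 + y / e' = 1 + y + y * (k * (1 + B)).
    by rewrite /k divfK ?gt_eqF//; ring.
  have -> : (1 + y) * (1 + k * y) = 1 + y + y * (k * (1 + y)) by ring.
  by rewrite lerD2l ler_wpM2l// ler_pM2l// lerD2l.
have xy : y / e' <= x.
  rewrite ler_pdivrMr// (le_trans yex)// [leRHS]mulrC.
  by apply: ler_wpM2r => //; rewrite /e'; lra.
rewrite ler_ln ?posrE ?mulr_gt0//; last by lra.
by rewrite (le_trans prod_le)// lerD2l.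
Qed.

Section renyi_coefficient_lt1.
Variables (R : realType) (T : Type) (A : T -> Prop).
Variables (D : T -> T -> \bar R) (K : T -> T) (alpha : R).
Hypotheses (alpha_gt1 : 1 < alpha) (hD : contracting A D K).

(* The ratio of two Renyi divergences degenerates to 1 when both divergences
   are large, hence the bound on the image of [K]. *)
Lemma renyi_coeff_lt1 (B : R) : (ergodicity_coeff A D K < 1)%E -> 0 <= B ->
  (forall p q, A p -> A q -> (D (K p) (K q) <= B%:E)%E) ->
  (ergodicity_coeff A (renyi_div D alpha) K < 1)%E.
Proof.
move=> ec1 B0 DB.
have alpha1 : alpha != 1 by rewrite gt_eqF.
have a10 : 0 < alpha - 1 by rewrite subr_gt0.
have hR := renyi_contracting alpha1 hD.
set e := fine (ergodicity_coeff A D K).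
have e0 : 0 <= e by exact: fine_ergodicity_coeff_ge0.
have e1 : e < 1 by rewrite -lte_fin -ergodicity_coeff_fin.
have [b /andP[b0 b1] hb] :=
  log_contraction e0 e1 (mulr_ge0 (ltW a10) B0).
apply: (@le_lt_trans _ _ b%:E); last by rewrite lte_fin.
apply: (ergodicity_coeff_le hR b0) => p q r r' Ap Aq _ Rr Rr' r0 r'0.
have D0 : (0 <= D p q)%E.
  by have [_ D'0 D'D] := hD; rewrite (le_trans (D'0 _ _ Ap Aq))// D'D.
have [d [Dd d0 h ->]] := renyi_of_fin alpha1 D0 Rr.
have [d' [Dd' d'0 _ d'e]] := ergodicity_coeff_bound hD Ap Aq Dd.
move: Rr'; rewrite (renyi_div_fin alpha_gt1 d'0 Dd') => -[<-].
rewrite /renyi_fun mulrA ler_pM2r ?invr_gt0//; apply: hb.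
- by rewrite mulr_ge0// ltW.
- by rewrite mulr_ge0// ltW.
- by rewrite mulrCA ler_pM2l.
- by rewrite ler_pM2l// -lee_fin -Dd' DB.
Qed.

End renyi_coefficient_lt1.

(** * Convexity, symmetry and equivalence of the Renyi coefficients of order below one *)

Section renyi_coefficient_order_lt1.
Variables (R : realType) (n : nat) (pi : 'rV[R]_n).
Hypotheses (hpi : is_pmf pi) (hpi0 : forall x, 0 < pi 0 x).
Implicit Types (M L P : 'M[R]_n) (a b t : R).

Lemma renyi_fun_convex a t x y : a < 1 -> 0 <= t -> t <= 1 ->
  0 < 1 + (a - 1) * x -> 0 < 1 + (a - 1) * y ->
  0 < 1 + (a - 1) * (t * x + (1 - t) * y) /\
  renyi_fun a (t * x + (1 - t) * y) <= t * renyi_fun a x + (1 - t) * renyi_fun a y.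
Proof.
move=> a1 t0 t1 hx hy.
have a10 : (a - 1)^-1 < 0 by rewrite invr_lt0 subr_lt0.
have E : 1 + (a - 1) * (t * x + (1 - t) * y) =
  t * (1 + (a - 1) * x) + (1 - t) * (1 + (a - 1) * y) by ring.
split.
  rewrite E; have := convR_gt0 (Itv01 t0 t1) hx hy; exact.
rewrite /renyi_fun !mulrA -mulrDl ler_nM2r// E.
exact: (concave_ln (Itv01 t0 t1) hx hy).
Qed.

(** For orders below 1 the Renyi divergence is a nondecreasing convex function of D_a, and D_a of
    the images is convex in the transition matrix. *)
Lemma etaR_convex a P1 P2 t : 0 < a -> a < 1 ->
  is_transition P1 -> is_transition P2 -> 0 <= t -> t <= 1 ->
  (etaR pi a (t *: P1 + (1 - t) *: P2)
    <= t%:E * etaR pi a P1 + (1 - t)%:E * etaR pi a P2)%E.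
Proof.
move=> a0 a1 h1 h2 t0 t1.
have an1 : a != 1 by rewrite lt_eqF.
have cf : convex_on_nonneg (alpha_gen a).
  by apply: alpha_gen_convex => //; apply/eqP.
have f1 := alpha_gen1 a.
have h3 := transition_conv h1 h2 t0 t1.
have hR P : is_transition P -> contracting (@is_transition R n)
    (renyi pi a) (fun M => M *m P).
  by move=> hP; exact: renyi_contracting an1 (fdiv_contracting hpi0 cf f1 hP).
apply: ergodicity_coeff_convex => //; try exact: hR.
move=> M L r1 r2 hM hL R1 R2.
have Dge0 P : is_transition P ->
    (0 <= fdiv pi (alpha_gen a) (M *m P) (L *m P))%E.
  by move=> hP; apply: fdiv_ge0 => //; exact: transition_mulmx.
have [d1 [Dd1 d10 hd1 ->]] := renyi_of_fin an1 (Dge0 _ h1) R1.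
have [d2 [Dd2 d20 hd2 ->]] := renyi_of_fin an1 (Dge0 _ h2) R2.
have [hd3 r3] := renyi_fun_convex a1 t0 t1 hd1 hd2.
have D3 := fdiv_convex hpi0 cf f1 t0 t1 hM hL h1 h2 Dd1 Dd2.
apply: le_trans (renyi_of_homo an1 D3) _.
by rewrite renyi_of_EFin// lee_fin.
Qed.

Lemma contracting_swap (T : Type) (A : T -> Prop) (D : T -> T -> \bar R) K :
  contracting A D K -> contracting A (fun p q => D q p) K.
Proof. by move=> [D0 D'0 D'D]; split=> // p q Ap Aq; [exact: D'0|exact: D'D]. Qed.

(** The constant [k] cancels in every ratio, and the supremum ignores the order of the pair. *)
Lemma skew_symmetric_coeff_le (T : Type) (A : T -> Prop)
    (D1 D2 : T -> T -> \bar R) (K : T -> T) (k : R) : 0 < k ->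
  (forall p, A p -> A (K p)) -> contracting A D1 K -> contracting A D2 K ->
  (forall p q, A p -> A q -> D1 p q = (k%:E * D2 q p)%E) ->
  (ergodicity_coeff A D1 K <= ergodicity_coeff A D2 K)%E.
Proof.
move=> k0 AK h1 h2 H.
rewrite -[leRHS]mul1e -(divff (lt0r_neq0 k0)) -(ergodicity_coeff_swap A D2).
apply: ergodicity_coeff_compare => //; first exact: contracting_swap.
- by move=> p q Ap Aq; rewrite H.
- by move=> p q Ap Aq; rewrite H.
Qed.

Let renyi_hcontracting a P : 0 < a -> a < 1 -> is_transition P ->
  contracting (@is_transition R n) (renyi pi a) (fun M => M *m P).
Proof.
move=> a0 a1 hP; have an1 : a != 1 by rewrite lt_eqF.
apply: (renyi_contracting an1); apply: fdiv_contracting => //.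
  by apply: alpha_gen_convex => //; apply/eqP.
exact: alpha_gen1.
Qed.

Lemma etaR_symmetric_le a P : 0 < a -> a < 1 -> is_transition P ->
  (etaR pi a P <= etaR pi (1 - a) P)%E.
Proof.
move=> a0 a1 hP; have a01 : 0 < 1 - a by rewrite subr_gt0.
apply: (@skew_symmetric_coeff_le _ _ _ _ _ (a / (1 - a))).
- by rewrite divr_gt0.
- by move=> M hM; exact: transition_mulmx.
- exact: renyi_hcontracting.
- by apply: renyi_hcontracting => //; lra.
- by move=> M L hM hL; rewrite renyi_swap.
Qed.

Lemma eta_alpha_symmetric_le a P : 0 < a -> a < 1 -> is_transition P ->
  (eta pi (alpha_gen a) P <= eta pi (alpha_gen (1 - a)) P)%E.
Proof.
move=> a0 a1 hP; have a01 : 0 < 1 - a by rewrite subr_gt0.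
have a11 : 1 - a < 1 by rewrite gtrBl.
apply: (@skew_symmetric_coeff_le _ _ _ _ _ (a / (1 - a))).
- by rewrite divr_gt0.
- by move=> M hM; exact: transition_mulmx.
- apply: fdiv_contracting => //; last exact: alpha_gen1.
  by apply: alpha_gen_convex => //; apply/eqP; rewrite lt_eqF.
- apply: fdiv_contracting => //; last exact: alpha_gen1.
  by apply: alpha_gen_convex => //; apply/eqP; rewrite lt_eqF.
- move=> M L hM hL; rewrite !fdiv_hellinger// hellinger_swap.
  have -> : 1 - (1 - a) = a by ring.
  by rewrite -EFinM; congr EFin; field; rewrite !gt_eqF.
Qed.

(** Both bounds come from c R_b <= R_a <= R_b. The right inequality is monotonicity in the order;
    the left one is the same monotonicity at the orders 1 - b < 1 - a, brought back by the skew
    symmetry. *)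
Lemma etaR_equivalence a b P : 0 < a -> a < b -> b < 1 -> is_transition P ->
  ((a / b * ((1 - b) / (1 - a)))%:E * etaR pi b P <= etaR pi a P)%E /\
  (etaR pi a P <= (b / a * ((1 - a) / (1 - b)))%:E * etaR pi b P)%E.
Proof.
move=> a0 ab b1 hP; set c := a / b * _; set c' := b / a * _.
have b0 : 0 < b by exact: lt_trans ab.
have a1 : a < 1 by exact: lt_trans b1.
have a01 : 0 < 1 - a by rewrite subr_gt0.
have b01 : 0 < 1 - b by rewrite subr_gt0.
have c0 : 0 < c by rewrite mulr_gt0 ?divr_gt0.
have c'E : c' = c^-1.
  by rewrite /c /c' !invfM !invrK [a^-1 * b]mulrC [_^-1 * (1 - a)]mulrC.
have AK M : is_transition M -> is_transition (M *m P).
  by move=> hM; exact: transition_mulmx.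
have Rab M L : is_transition M -> is_transition L ->
  (renyi pi a M L <= renyi pi b M L)%E by exact: renyi_le_order.
have cR M L : is_transition M -> is_transition L ->
    (c%:E * renyi pi b M L <= renyi pi a M L)%E.
  move=> hM hL; rewrite (renyi_swap hpi hpi0 b0 b1)// (renyi_swap hpi hpi0 a0 a1)//.
  rewrite muleA -EFinM.
  have -> : c * (b / (1 - b)) = a / (1 - a) by rewrite /c; field; rewrite !gt_eqF.
  apply: lee_wpmul2l; first by rewrite lee_fin divr_ge0// ltW.
  by apply: renyi_le_order => //; lra.
have Rb M L : is_transition M -> is_transition L ->
    (renyi pi b M L <= c^-1%:E * renyi pi a M L)%E.
  by move=> hM hL; rewrite lee_pdivlMl// cR.
have ha := renyi_hcontracting a0 a1 hP.
have hb := renyi_hcontracting b0 b1 hP.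
split.
  rewrite -lee_pdivlMl// -[c^-1]divr1.
  apply: ergodicity_coeff_compare => //; rewrite ?invr_gt0//.
  by move=> M L hM hL; rewrite mul1e Rab.
rewrite c'E -[c^-1]mul1r.
apply: ergodicity_coeff_compare => //.
by move=> M L hM hL; rewrite mul1e Rab.
Qed.

End renyi_coefficient_order_lt1.

(** * Positivity, scrambling and rank *)

Section positivity.
Variables (R : realType) (n : nat) (f : R -> R).
Hypotheses (cf : convex_on_nonneg f) (f1 : f 1 = 0).
Hypothesis sf : strictly_convex_at1 f.
Implicit Types (mu nu : 'rV[R]_n).

(** For l < 1 this is strict convexity at m / l < 1 < (1 - m) / (1 - l) with weight l. For l = 1 the
    second pair lies on the edge: the pair (m, 1) is cut into two halves and one half is merged with
    (1 - m, 0), which reduces to the reference weight 1/2. *)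
Lemma binary_div_gt0 m l : 0 <= m -> m < l -> l <= 1 ->
  (0 < fdiv_term f m l + fdiv_term f (1 - m) (1 - l))%E.
Proof.
have lt1 (p q : R) : 0 <= p -> p < q -> q < 1 ->
    (0 < fdiv_term f p q + fdiv_term f (1 - p) (1 - q))%E.
  move=> p0 pq q1; have q0 : 0 < q by lra.
  have q1' : 0 < 1 - q by lra.
  rewrite !fdiv_term_neq0 ?gt_eqF// -EFinD lte_fin -f1.
  apply: sf; rewrite ?divr_ge0// ?ltW//.
  - by rewrite ltr_pdivrMr// mul1r.
  - by rewrite ltr_pdivlMr// mul1r; lra.
  - by field; rewrite !gt_eqF.
move=> m0 ml; rewrite le_eqVlt => /predU1P[l1|]; last exact: lt1.
rewrite l1 in ml *; rewrite subrr.
have h2 : 0 <= 2^-1 :> R by rewrite invr_ge0.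
have m2 : 0 <= 2^-1 * m by rewrite mulr_ge0.
have h21 : 2^-1 <= 1 :> R by lra.
have : (0 < fdiv_term f (2^-1 * m) 2^-1 +
            fdiv_term f (1 - 2^-1 * m) (1 - 2^-1))%E by apply: lt1 => //; lra.
move=> /lt_le_trans; apply.
have half : (fdiv_term f m 1 =
    fdiv_term f (2^-1 * m) 2^-1 + fdiv_term f (2^-1 * m) 2^-1)%E.
  have -> : fdiv_term f (2^-1 * m) 2^-1 = (2^-1%:E * fdiv_term f m 1)%E.
    by rewrite -fdiv_termZ// mulr1.
  rewrite fdiv_term_neq0 ?oner_eq0// -!EFinM -EFinD; congr EFin.
  by field.
rewrite half -addeA leeD2l//.
have -> : 1 - 2^-1 * m = 2^-1 * m + (1 - m) by field.
have -> : 1 - 2^-1 = 2^-1 + 0 :> R by field.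
by apply: fdiv_termD => //; lra.
Qed.

(** Merging the states where mu < nu into one point and the others into a second one does not
    increase the divergence, and leaves two distinct binary laws. *)
Lemma fdivt_gt0 mu nu : is_pmf mu -> is_pmf nu -> mu <> nu ->
  (0 < fdivt f mu nu)%E.
Proof.
move=> [mu0 mu1] [nu0 nu1] munu.
have [x hx] : exists x, mu 0 x < nu 0 x.
  apply: contrapT => h; apply: munu; apply/rowP => x.
  have ge0 y : 0 <= mu 0 y - nu 0 y.
    by rewrite subr_ge0 leNgt; apply/negP => hy; apply: h; exists y.
  have /psumr_eq0P : forall y, true -> 0 <= mu 0 y - nu 0 y by move=> y _.
  rewrite sumrB mu1 nu1 subrr => /(_ erefl x isT)/eqP.
  by rewrite subr_eq0 => /eqP.
pose A := [pred y | mu 0 y < nu 0 y].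
have split_sum (m : 'rV[R]_n) : \sum_y m 0 y = 1 ->
    \sum_(y | ~~ A y) m 0 y = 1 - \sum_(y | A y) m 0 y.
  by move=> <-; rewrite [X in X - _](bigID A)/= addrAC subrr add0r.
have lt_sum : \sum_(y | A y) mu 0 y < \sum_(y | A y) nu 0 y.
  rewrite -subr_gt0 -sumrB (bigD1 x)//= ltr_pwDl ?subr_gt0// sumr_ge0// => y.
  by rewrite subr_ge0 => /andP[/ltW].
rewrite /fdivt (bigID A)/=.
apply: (@lt_le_trans _ _ (fdiv_term f (\sum_(y | A y) mu 0 y) (\sum_(y | A y) nu 0 y) +
  fdiv_term f (\sum_(y | ~~ A y) mu 0 y) (\sum_(y | ~~ A y) nu 0 y))%E); last first.
  by apply: leeD; exact: fdiv_term_esum.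
rewrite !split_sum//; apply: binary_div_gt0 => //; first by rewrite sumr_ge0.
by rewrite -nu1 [leRHS](bigID A)/= lerDl sumr_ge0.
Qed.

Lemma fdiv_gt0 (pi : 'rV[R]_n) (M L : 'M[R]_n) : (forall x, 0 < pi 0 x) ->
  is_transition M -> is_transition L -> M <> L -> (0 < fdiv pi f M L)%E.
Proof.
move=> pi0 hM hL ML.
have [x hx] : exists x, row x M <> row x L.
  apply: contrapT => h; apply: ML; apply/row_matrixP => x.
  by apply: contrapT => hx; apply: h; exists x.
rewrite /fdiv (bigD1 x)//=; apply: lte_paddr.
  by apply: sume_ge0 => y _; rewrite mule_ge0 ?fdivt_ge0// lee_fin ltW.
by rewrite mule_gt0 ?lte_fin//; exact: fdivt_gt0.
Qed.

End positivity.

(** * Laws carried by two states *)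

Section two_point.
Variables (R : realType) (n : nat).
Implicit Types (f : R -> R) (P : 'M[R]_n) (p q : R) (x y : 'I_n).

Definition two_point x y p : 'rV[R]_n :=
  \row_z (p * (z == x)%:R + (1 - p) * (z == y)%:R).

Lemma sum_indicator x (F : 'I_n -> R) : \sum_z (z == x)%:R * F z = F x.
Proof.
rewrite (bigD1 x)//= eqxx mul1r big1 ?addr0// => z /negPf ->.
by rewrite mul0r.
Qed.

Lemma two_point_pmf x y p : 0 <= p -> p <= 1 -> is_pmf (two_point x y p).
Proof.
move=> p0 p1; have p1' : 0 <= 1 - p by rewrite subr_ge0.
split=> [z|]; first by rewrite mxE addr_ge0// mulr_ge0// ler0n.
under eq_bigr do rewrite mxE -[_ * (_ == x)%:R]mulrC -[_ * (_ == y)%:R]mulrC.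
by rewrite big_split/= !sum_indicator; ring.
Qed.

Lemma two_point_mulmx x y p P z :
  (two_point x y p *m P) 0 z = p * P x z + (1 - p) * P y z.
Proof.
rewrite mxE; under eq_bigr do rewrite mxE mulrDl -!mulrA.
by rewrite big_split/= -!mulr_sumr !sum_indicator.
Qed.

Lemma fdivt_two_point f x y p q : convex_on_nonneg f -> x != y ->
  fdivt f (two_point x y p) (two_point x y q) =
  (fdiv_term f p q + fdiv_term f (1 - p) (1 - q))%E.
Proof.
move=> cf xy; rewrite /fdivt (bigD1 x)//= (bigD1 y) 1?eq_sym//= !mxE.
rewrite eqxx (negPf xy) eq_sym (negPf xy) eqxx !mulr0 !mulr1 !addr0 !add0r.
rewrite big1 ?adde0// => z /andP[/negPf zx /negPf zy].
by rewrite !mxE zx zy !mulr0 addr0 fdiv_term0 mul0e.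
Qed.

(* The image of a two-point law under two mutually singular rows is an
   isometric copy of it. *)
Lemma fdivt_two_point_singular f x y p q P : convex_on_nonneg f ->
  is_transition P -> (forall z, P x z = 0 \/ P y z = 0) ->
  0 < q -> q < 1 ->
  fdivt f (two_point x y p *m P) (two_point x y q *m P) =
  (fdiv_term f p q + fdiv_term f (1 - p) (1 - q))%E.
Proof.
move=> cf hP sing q0 q1; have q1' : 0 < 1 - q by rewrite subr_gt0.
rewrite !(fdiv_term_neq0 f) ?gt_eqF// -EFinD.
set a := q * _; set b := (1 - q) * _.
have -> : a + b = \sum_z (P x z * a + P y z * b).
  by rewrite big_split/= -!mulr_suml !transition_sum// !mul1r.
rewrite -sumEFin; apply: eq_bigr => z _; rewrite !two_point_mulmx.
have [->|->] := sing z.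
  rewrite !mulr0 !add0r mul0r add0r ![_ * P y z]mulrC fdiv_termZ ?transition_ge0//.
  by rewrite fdiv_term_neq0 ?gt_eqF.
rewrite !mulr0 !addr0 mul0r addr0 ![_ * P x z]mulrC fdiv_termZ ?transition_ge0//.
by rewrite fdiv_term_neq0 ?gt_eqF.
Qed.

(** The vanishing binary divergences tie the values of [f] on the two sides of 1. The points 0 and u
    > 1 determine [f] beyond 1, with slope - f 0; the points t < 1 and 2 then determine it below
    1. *)
Lemma trivial_generatorP f : f 1 = 0 ->
  (forall p q, 0 <= p -> p <= 1 -> 0 < q -> q < 1 ->
     q * f (p / q) + (1 - q) * f ((1 - p) / (1 - q)) = 0) ->
  trivial_generator f.
Proof.
move=> f1 H.
have H' s t l : 0 <= s -> s < 1 -> 1 < t -> 0 < l -> l < 1 ->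
    l * s + (1 - l) * t = 1 -> l * f s + (1 - l) * f t = 0.
  move=> s0 s1 t1 l0 l1 st; have := H (l * s) l.
  have -> : l * s / l = s by field; rewrite gt_eqF.
  have -> : (1 - l * s) / (1 - l) = t.
    have -> : 1 - l * s = (1 - l) * t by lra.
    by rewrite mulrAC divff ?mul1r// gt_eqF// subr_gt0.
  apply=> //; [by rewrite mulr_ge0// ltW|rewrite -st lerDl mulr_ge0//; lra].
exists (- f 0) => t t0.
have f0 u : 1 < u -> f u = - f 0 * (u - 1).
  move=> u1; have u0 : 0 < u by lra.
  have uV : 0 < u^-1 by rewrite invr_gt0.
  have uV1 : u^-1 < 1 by rewrite invf_lt1.
  have := H' 0 u (1 - u^-1) (lexx _) ltr01 u1 ltac:(lra) ltac:(lra).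
  rewrite mulr0 add0r (_ : 1 - (1 - u^-1) = u^-1); last by ring.
  rewrite mulVf ?gt_eqF// => /(_ erefl) h.
  apply: (mulfI (lt0r_neq0 uV)).
  have -> : u^-1 * (- f 0 * (u - 1)) = - ((1 - u^-1) * f 0).
    by field; rewrite gt_eqF.
  by lra.
have [t1|t1|->] := ltgtP t 1; last by rewrite subrr mulr0.
  have t2 : 0 < 2 - t by lra.
  have tV : 0 < (2 - t)^-1 by rewrite invr_gt0.
  have tV1 : (2 - t)^-1 < 1 by rewrite invf_lt1//; lra.
  have := H' t 2 (2 - t)^-1 t0 t1 ltac:(lra) tV tV1.
  rewrite (f0 2) ?ltr1n// => h.
  have {}h := h ltac:(field; rewrite gt_eqF//).
  apply: (mulfI (lt0r_neq0 tV)).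
  have -> : (2 - t)^-1 * (- f 0 * (t - 1)) = (1 - (2 - t)^-1) * f 0.
    by field; rewrite gt_eqF.
  by lra.
exact: f0.
Qed.

End two_point.

Section scrambling_and_rank.
Variables (R : realType) (n : nat) (pi : 'rV[R]_n).
Hypotheses (hpi : is_pmf pi) (hpi0 : forall x, 0 < pi 0 x).
Implicit Types (f : R -> R) (P : 'M[R]_n).

Lemma fdiv_term_tv (m l : R) : l != 0 \/ m = 0 -> 0 <= l ->
  fdiv_term (@tv_gen R) m l = (`|m - l| / 2)%:E.
Proof.
move=> h l0; have [l00|lN0] := eqVneq l 0.
  have -> : m = 0 by case: h => //; rewrite l00 eqxx.
  by rewrite l00 fdiv_term0 mul0e subrr normr0 mul0r.
rewrite fdiv_term_neq0// /tv_gen mulrA -[X in X * `|_|](ger0_norm l0) -normrM.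
by rewrite mulrBr mulr1 [l * (m / l)]mulrC divfK.
Qed.

(** The laws with weights 3/4 and 1/4 on x are at distance 1/2, and their images differ by (P x - P
    y) / 2. Interior weights make the second law positive wherever the first one is, before and
    after [P], so the value at l = 0 never enters. *)
Lemma overlap_le_etat_tv P x y : is_transition P -> x != y ->
  1 - \sum_z Num.min (P x z) (P y z) <= fine (etat (@tv_gen R) P).
Proof.
move=> hP xy; have ctv := @tv_gen_convex R.
have ht := fdivt_contracting ctv (tv_gen1 R) hP.
have h34 : (0 : R) <= 3 / 4 by lra.
have h34' : 3 / 4 <= (1 : R) by lra.
have h14 : (0 : R) <= 1 / 4 by lra.
have h14' : 1 / 4 <= (1 : R) by lra.
have Dd : fdivt (@tv_gen R) (two_point x y (3 / 4)) (two_point x y (1 / 4)) =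
    (1 / 2)%:E.
  have l1 : 0 < 1 / 4 :> R by lra.
  have l2 : 0 < 1 - 1 / 4 :> R by lra.
  rewrite fdivt_two_point// (fdiv_term_tv _ (ltW l1)); last by left; rewrite gt_eqF.
  rewrite (fdiv_term_tv _ (ltW l2)); last by left; rewrite gt_eqF.
  rewrite -EFinD; congr EFin.
  rewrite ger0_norm; last by lra.
  by rewrite ler0_norm; lra.
have [d' [Dd' _ _]] := ergodicity_coeff_bound ht (two_point_pmf x y h34 h34')
  (two_point_pmf x y h14 h14') Dd.
suff -> : d' = (1 - \sum_z Num.min (P x z) (P y z)) / 2.
  by rewrite /etat; lra.
apply: EFin_inj; rewrite -Dd'.
have -> : 1 - \sum_z Num.min (P x z) (P y z) = \sum_z `|P x z - P y z| / 2.
  have E z : `|P x z - P y z| / 2 =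
      (P x z + P y z) / 2 - Num.min (P x z) (P y z).
    have [h|h] := leP (P x z) (P y z).
      by rewrite ler0_norm ?subr_le0//; field.
    by rewrite gtr0_norm ?subr_gt0//; field.
  under [RHS]eq_bigr do rewrite E.
  by rewrite sumrB -mulr_suml big_split/= !transition_sum//; lra.
rewrite mulr_suml -sumEFin; apply: eq_bigr => z _; rewrite !two_point_mulmx.
have Px := transition_ge0 x z hP; have Py := transition_ge0 y z hP.
rewrite fdiv_term_tv; last 2 first.
- have [->|h] := eqVneq (P x z) 0; last first.
    have : 0 < P x z by rewrite lt_neqAle eq_sym h.
    by left; rewrite gt_eqF//; lra.
  have [->|h'] := eqVneq (P y z) 0; first by right; rewrite !mulr0 addr0.
  have : 0 < P y z by rewrite lt_neqAle eq_sym h'.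
  by left; rewrite gt_eqF//; lra.
- by lra.
have -> : 3 / 4 * P x z + (1 - 3 / 4) * P y z -
  (1 / 4 * P x z + (1 - 1 / 4) * P y z) = (P x z - P y z) / 2 by field.
by congr EFin; rewrite normrM [`|2^-1|]ger0_norm// invr_ge0.
Qed.

Lemma etat_le f P (c : R) : convex_on_nonneg f -> f 1 = 0 -> is_transition P ->
  0 <= c -> (forall x y, x != y -> 1 - \sum_z Num.min (P x z) (P y z) <= c) ->
  (etat f P <= c%:E)%E.
Proof.
move=> cf f1 hP c0 hc.
apply: (ergodicity_coeff_le (fdivt_contracting cf f1 hP) c0).
move=> mu nu d d' hmu hnu _ Dd Dd' _ _; rewrite -lee_fin -Dd'.
exact: fdivt_contraction.
Qed.

Lemma etat_le_tv f P : convex_on_nonneg f -> f 1 = 0 -> is_transition P ->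
  (etat f P <= etat (@tv_gen R) P)%E.
Proof.
move=> cf f1 hP.
have ht := fdivt_contracting (@tv_gen_convex R) (tv_gen1 R) hP.
rewrite [leRHS](ergodicity_coeff_fin ht); apply: etat_le => //.
  exact: fine_ergodicity_coeff_ge0.
by move=> x y; exact: overlap_le_etat_tv.
Qed.

Lemma scrambling_etat_lt1 f P : convex_on_nonneg f -> f 1 = 0 ->
  is_transition P -> scrambling P -> (etat f P < 1)%E.
Proof.
move=> cf f1 hP sP.
pose S (p : 'I_n * 'I_n) := \sum_z Num.min (P p.1 z) (P p.2 z).
(* Least overlap over finitely many pairs of rows; the initial value 1 guarantees that 1 - m is
   nonnegative. *)
pose m := \big[Order.min/(1 : R)]_p S p.
have m0 : 0 < m.
  apply: lt_bigmin => // -[x y] _; have [z [Pxz Pyz]] := sP x y.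
  rewrite /S (bigD1 z)//= ltr_pwDl ?lt_min ?Pxz// sumr_ge0// => w _.
  by rewrite le_min !transition_ge0.
have m1 : m <= 1 by exact: bigmin_le_id.
apply: (@le_lt_trans _ _ (1 - m)%:E); last by rewrite lte_fin; lra.
apply: etat_le => //; first by rewrite subr_ge0.
move=> x y _; rewrite lerD2l lerN2.
exact: (bigmin_le _ (x, y)).
Qed.

(** Two rows with disjoint supports make [P] preserve the divergence of laws on x and y with an
    interior reference. A coefficient below 1 then forces all these binary divergences to be 0,
    hence a trivial generator. *)
Lemma etat_lt1_scrambling f P : convex_on_nonneg f -> f 1 = 0 ->
  is_transition P -> ~ trivial_generator f -> (etat f P < 1)%E -> scrambling P.
Proof.
move=> cf f1 hP ntf e1 x y; apply: contrapT => hz.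
have sing z : P x z = 0 \/ P y z = 0.
  have [Px|Px] := eqVneq (P x z) 0; first by left.
  right; apply: contrapT => /eqP Py; apply: hz; exists z.
  by rewrite !lt_neqAle !transition_ge0// ![0 == _]eq_sym Px Py.
have xy : x != y.
  apply/eqP => xy; have := transition_sum x hP; rewrite big1.
    by move/eqP; rewrite eq_sym oner_eq0.
  by move=> z _; case: (sing z) => //; rewrite -xy.
apply: ntf; apply: trivial_generatorP => // p q p0 p1 q0 q1.
have hp := two_point_pmf x y p0 p1.
have hq := two_point_pmf x y (ltW q0) (ltW q1).
have q1' : 0 < 1 - q by rewrite subr_gt0.
have Dd : fdivt f (two_point x y p) (two_point x y q) =
    (q * f (p / q) + (1 - q) * f ((1 - p) / (1 - q)))%:E.
  by rewrite fdivt_two_point// !fdiv_term_neq0 ?gt_eqF.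
apply: contrapT => /eqP d0.
have := fdivt_ge0 cf f1 hp hq; rewrite Dd lee_fin => dge0.
have ht := fdivt_contracting cf f1 hP.
apply: (ergodicity_coeff_lt1 ht hp hq Dd _ _ e1).
  by rewrite lt_neqAle eq_sym d0.
by rewrite fdivt_two_point_singular// fdivt_two_point.
Qed.

(** In rank one every row is a multiple of any other, and the row sums force the factor to be 1. *)
Lemma rank1_rows P : is_transition P ->
  \rank P = 1%N <-> forall x y, row x P = row y P.
Proof.
move=> hP; have [x0] := state_inhabited hpi.
have rowN0 x : row x P != 0.
  apply/eqP => h; have [_] := hP x; rewrite h big1 => [/esym/eqP|y _].
    by rewrite oner_eq0.
  by rewrite mxE.
split=> [rP x y|h].
  have eqP0 z w : row w P = row z P.
    have sub : (row z P <= P)%MS by exact: row_sub.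
    have : (P <= row z P)%MS.
      rewrite -(geq_leqif (mxrank_leqif_sup sub)) rP.
      by rewrite lt0n mxrank_eq0.
    move=> /(submx_trans (row_sub w P))/sub_rVP[a rw].
    have [_] := hP w; rewrite rw; under eq_bigr do rewrite mxE.
    rewrite -mulr_sumr; case: (hP z) => _ ->; rewrite mulr1 => ->.
    by rewrite scale1r.
  exact: eqP0.
apply/eqP; rewrite eqn_leq; apply/andP; split.
  have -> : P = const_mx 1 *m row x0 P :> 'M[R]_n.
    apply/row_matrixP => x; rewrite row_mul (h x x0).
    by apply/rowP => y; rewrite !mxE big_ord1 !mxE mul1r.
  exact: (mulmx_max_rank (const_mx 1 : 'cV[R]_n) (row x0 P)).
by apply: leq_trans (mxrankS (row_sub x0 P)); rewrite lt0n mxrank_eq0.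
Qed.

Lemma equal_rows_mulmx P mu nu : is_pmf mu -> is_pmf nu ->
  (forall x y, row x P = row y P) -> mu *m P = nu *m P.
Proof.
move=> [_ mu1] [_ nu1] h; have [x0] := state_inhabited hpi.
have E (m : 'rV[R]_n) : \sum_y m 0 y = 1 -> m *m P = row x0 P.
  move=> m1; apply/rowP => z; rewrite !mxE -[RHS]mul1r -m1 mulr_suml.
  by apply: eq_bigr => y _; congr (_ * _); have := h y x0 => /rowP/(_ z); rewrite !mxE.
by rewrite !E.
Qed.

Lemma etat_eq0_rows f P : convex_on_nonneg f -> f 1 = 0 ->
  strictly_convex_at1 f -> is_transition P -> etat f P = 0%E ->
  forall x y, row x P = row y P.
Proof.
move=> cf f1 sf hP e0 x y; apply: contrapT => rxy.
have xy : x != y by apply/eqP => xy; apply: rxy; rewrite xy.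
(* The weights 1/2 and 1/4 are distinct and the second is interior: the divergence is finite, and
   the images differ by (P x - P y) / 4. *)
have h12 : (0 : R) <= 1 / 2 by lra.
have h12' : 1 / 2 <= (1 : R) by lra.
have h14 : (0 : R) <= 1 / 4 by lra.
have h14' : 1 / 4 <= (1 : R) by lra.
have hp := two_point_pmf x y h12 h12'.
have hq := two_point_pmf x y h14 h14'.
have Dfin : fdivt f (two_point x y (1 / 2)) (two_point x y (1 / 4)) != +oo%E.
  have l1 : 0 < 1 / 4 :> R by lra.
  have l2 : 0 < 1 - 1 / 4 :> R by lra.
  by rewrite fdivt_two_point// !fdiv_term_neq0 ?(gt_eqF l1) ?(gt_eqF l2).
have := ergodicity_coeff_eq0 (fdivt_contracting cf f1 hP) hp hq Dfin e0.
apply/eqP; rewrite gt_eqF//.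
apply: fdivt_gt0 => //; try exact: pmf_mulmx.
move=> E; apply: rxy; apply/rowP => z; move/rowP/(_ z): E.
rewrite !two_point_mulmx !mxE; lra.
Qed.

(** With a common support each column of [P] is either zero or everywhere positive, hence at least
    the smallest positive entry [c]. Image laws then have the same zeros and quotients at most 1 /
    c, which gives the uniform bound [B] that [renyi_coeff_lt1] requires. *)
Lemma renyi_scrambling_lt1 (beta : R) P : 1 < beta -> is_transition P ->
  scrambling P -> common_support P -> (etaR pi beta P < 1)%E.
Proof.
move=> b1 hP sP csP; have b0 : 0 < beta by lra.
have bN1 : beta <> 1 by apply/eqP; rewrite gt_eqF.
have cb : convex_on_nonneg (alpha_gen beta) by exact: alpha_gen_convex.
have fb1 := alpha_gen1 beta.
have b10 : 0 < beta - 1 by lra.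
pose c := \big[Order.min/(1 : R)]_(p : 'I_n * 'I_n | 0 < P p.1 p.2) P p.1 p.2.
have c0 : 0 < c by exact: lt_bigmin.
have cP x z : 0 < P x z -> c <= P x z.
  by move=> h; exact: (@bigmin_le_cond _ _ _ _ (x, z)).
pose B := c^-1 `^ beta / (beta - 1).
have B0 : 0 <= B by rewrite divr_ge0 ?powR_ge0 ?ltW.
have lower mu z : is_pmf mu -> (mu *m P) 0 z = 0 \/ c <= (mu *m P) 0 z.
  move=> hmu; have [x0] := state_inhabited hpi.
  have [Px|Px] := eqVneq (P x0 z) 0.
    left; rewrite mxE big1// => x _; suff -> : P x z = 0 by rewrite mulr0.
    apply: contrapT => /eqP Pxz.
    have : 0 < P x0 z by apply: (csP x); rewrite lt_neqAle eq_sym Pxz transition_ge0.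
    by rewrite Px ltxx.
  right; rewrite -[c]mul1r mxE; case: hmu => mu0 <-; rewrite mulr_suml.
  apply: ler_sum => x _; rewrite ler_wpM2l// cP// (csP x0)//.
  by rewrite lt_neqAle eq_sym Px transition_ge0.
have iff0 mu nu z : is_pmf mu -> is_pmf nu -> (nu *m P) 0 z = 0 ->
    (mu *m P) 0 z = 0.
  move=> hmu [nu0 nu1] h0.
  have PN x : P x z = 0.
    apply: contrapT => /eqP Pxz.
    have PP y : 0 < P y z by apply: (csP x); rewrite lt_neqAle eq_sym Pxz transition_ge0.
    have : 0 < (nu *m P) 0 z; last by rewrite h0 ltxx.
    apply: (@lt_le_trans _ _ c) => //; rewrite -[c]mul1r mxE -nu1 mulr_suml.
    by apply: ler_sum => y _; rewrite ler_wpM2l// cP.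
  by rewrite mxE big1// => x _; rewrite PN mulr0.
have fdivtB mu nu : is_pmf mu -> is_pmf nu ->
    (fdivt (alpha_gen beta) (mu *m P) (nu *m P) <= B%:E)%E.
  move=> hmu hnu; have [mp0 mp1] := pmf_mulmx hmu hP.
  have [np0 np1] := pmf_mulmx hnu hP.
  rewrite -[B]mul1r -np1 mulr_suml -sumEFin; apply: lee_sum => z _.
  have [l0|lN0] := eqVneq ((nu *m P) 0 z) 0.
    by rewrite l0 (iff0 mu nu)// fdiv_term0 mul0e mul0r.
  rewrite fdiv_term_neq0// lee_fin ler_wpM2l// /alpha_gen /B.
  rewrite ler_pM2r ?invr_gt0//.
  apply: (@le_trans _ _ (((mu *m P) 0 z / (nu *m P) 0 z) `^ beta)).
    by rewrite gerBl.
  have lc : c <= (nu *m P) 0 z.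
    by case: (lower nu z hnu) => // h; move: lN0; rewrite h eqxx.
  have l_gt0 : 0 < (nu *m P) 0 z by exact: lt_le_trans lc.
  apply: ge0_ler_powR; first exact: ltW.
  - by rewrite nnegrE divr_ge0.
  - by rewrite nnegrE invr_ge0 ltW.
  apply: (@le_trans _ _ ((nu *m P) 0 z)^-1).
    rewrite ler_piMl ?invr_ge0// -mp1 (bigD1 z)//= lerDl sumr_ge0//.
  by rewrite lef_pV2.
have ec1 : (eta pi (alpha_gen beta) P < 1)%E.
  by rewrite (eta_etat hpi hpi0)//; exact: scrambling_etat_lt1.
apply: (renyi_coeff_lt1 b1 (fdiv_contracting hpi0 cb fb1 hP) ec1 B0) => M L hM hL.
have -> : B%:E = (\sum_x (pi 0%R x)%:E * B%:E)%E.
  rewrite -ge0_sume_distrl; last by move=> x _; rewrite lee_fin ltW.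
  by rewrite sumEFin; case: hpi => _ ->; rewrite mul1e.
apply: lee_sum => x _; apply: lee_wpmul2l; first by rewrite lee_fin ltW.
by rewrite !row_mul fdivtB.
Qed.

End scrambling_and_rank.

(** * Limits of transition matrices *)

Lemma cvg_sum_cst (R : realType) (n : nat) (u : nat -> 'I_n -> R) (l : 'I_n -> R)
    (s : R) : (forall x, (fun k => u k x) @ \oo --> l x) ->
  (forall k, \sum_x u k x = s) -> \sum_x l x = s.
Proof.
move=> ul us.
have h : (fun k => \sum_x u k x) @ \oo --> \sum_x l x.
  by apply: cvg_big => [|x _]; [exact: add_continuous|exact: ul].
have -> : s = lim ((fun k => \sum_x u k x) @ \oo).
  by under eq_fun do rewrite us; rewrite lim_cst.
by symmetry; apply/cvg_lim.
Qed.

Lemma pmf_limit (R : realType) (n : nat) (mu : nat -> 'rV[R]_n) (l : 'rV[R]_n) :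
  (forall k, is_pmf (mu k)) -> (forall x, (fun k => mu k 0 x) @ \oo --> l 0 x) ->
  is_pmf l.
Proof.
move=> hmu cv; split=> [x|].
  by apply: (cvgr_to_ge (cv x)); apply: nearW => k; exact: pmf_ge0.
by apply: (cvg_sum_cst cv) => k; case: (hmu k).
Qed.

Lemma transition_limit (R : realType) (n : nat) (M : nat -> 'M[R]_n) (L : 'M[R]_n) :
  (forall k, is_transition (M k)) ->
  (forall x y, (fun k => M k x y) @ \oo --> L x y) -> is_transition L.
Proof.
move=> hM cv x; apply: (@pmf_limit _ _ (fun k => row x (M k))) => [k|y].
  exact: hM.
by rewrite mxE; under eq_fun do rewrite mxE; exact: cv.
Qed.

Local Open Scope ereal_scope.

Theorem proposition3p9 (R : realType) (n : nat) (P : 'M[R]_n) (pi : 'rV[R]_n)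
    (alpha : R) (f : R -> R)
    (hP : is_transition P)
    (hpi : is_pmf pi) (hpi0 : forall x, (0 < pi 0%R x)%R)
    (halpha0 : (0 < alpha)%R) (halpha1 : alpha <> 1%R)
    (hf : convex_on_nonneg f) (hf1 : f 1%R = 0%R) :
  (* non-negativity and normalization *)
  ([/\ 0 <= eta pi f P, eta pi f P <= eta pi (@tv_gen R) P
     & eta pi (@tv_gen R) P <= 1]
   /\ (0 <= etaR pi alpha P /\ etaR pi alpha P <= 1)
   /\ (0 <= etatR alpha P /\ etatR alpha P <= 1))
  /\
  (* coefficients on pmfs versus on transition matrices *)
  (eta pi f P = etat f P /\ etatR alpha P <= etaR pi alpha P)
  /\
  (* bounds *)
  ([/\ (1 < alpha)%R ->
       eta pi (alpha_gen alpha) P <= etaR pi alpha P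
       /\ forall (U V : nat -> 'M[R]_n) (Ustar Vstar : 'M[R]_n),
         (forall k, is_transition (U k)) -> (forall k, is_transition (V k)) ->
         (fun k => renyi pi alpha (U k *m P)%R (V k *m P)%R
                   / renyi pi alpha (U k) (V k)) @ \oo --> etaR pi alpha P ->
         (forall x y, (fun k => U k x y) @ \oo --> Ustar x y) ->
         (forall x y, (fun k => V k x y) @ \oo --> Vstar x y) ->
         (fun k => fdiv pi (alpha_gen alpha) (U k) (V k)) @ \oo
           --> fdiv pi (alpha_gen alpha) Ustar Vstar ->
         (Ustar <> Vstar ->
            etaR pi alpha P
              <= log_ratio alpha (eta pi (alpha_gen alpha) P)
                   (fdiv pi (alpha_gen alpha) Ustar Vstar)
            /\ log_ratio alpha (eta pi (alpha_gen alpha) P)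
                   (fdiv pi (alpha_gen alpha) Ustar Vstar) <= 1)
         /\ (Ustar = Vstar ->
            etaR pi alpha P <= eta pi (alpha_gen alpha) P
            /\ eta pi (alpha_gen alpha) P <= 1),
       (1 < alpha)%R ->
       etat (alpha_gen alpha) P <= etatR alpha P
       /\ forall (mu nu : nat -> 'rV[R]_n) (mustar nustar : 'rV[R]_n),
         (forall k, is_pmf (mu k)) -> (forall k, is_pmf (nu k)) ->
         (fun k => renyit alpha (mu k *m P)%R (nu k *m P)%R
                   / renyit alpha (mu k) (nu k)) @ \oo --> etatR alpha P ->
         (forall x, (fun k => mu k 0%R x) @ \oo --> mustar 0%R x) ->
         (forall x, (fun k => nu k 0%R x) @ \oo --> nustar 0%R x) ->
         (fun k => fdivt (alpha_gen alpha) (mu k) (nu k)) @ \oo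
           --> fdivt (alpha_gen alpha) mustar nustar ->
         (mustar <> nustar ->
            etatR alpha P
              <= log_ratio alpha (etat (alpha_gen alpha) P)
                   (fdivt (alpha_gen alpha) mustar nustar)
            /\ log_ratio alpha (etat (alpha_gen alpha) P)
                   (fdivt (alpha_gen alpha) mustar nustar) <= 1)
         /\ (mustar = nustar ->
            etatR alpha P <= etat (alpha_gen alpha) P
            /\ etat (alpha_gen alpha) P <= 1)
     & forall beta : R, (0 < beta)%R -> (beta < 1)%R ->
       etaR pi beta P <= eta pi (alpha_gen beta) P
       /\ etatR beta P <= etat (alpha_gen beta) P])
  /\
  (* convexity *)
  (forall (P1 P2 : 'M[R]_n) (t : R),
     is_transition P1 -> is_transition P2 -> (0 <= t)%R -> (t <= 1)%R ->
     eta pi f (t *: P1 + (1 - t) *: P2)%R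
       <= t%:E * eta pi f P1 + (1 - t)%:E * eta pi f P2
     /\ ((alpha < 1)%R ->
         etaR pi alpha (t *: P1 + (1 - t) *: P2)%R
           <= t%:E * etaR pi alpha P1 + (1 - t)%:E * etaR pi alpha P2))
  /\
  (* submultiplicativity *)
  (forall Q : 'M[R]_n, is_transition Q ->
     eta pi f (P *m Q)%R <= eta pi f P * eta pi f Q)
  /\
  (* symmetry *)
  ((alpha < 1)%R ->
     etaR pi alpha P = etaR pi (1 - alpha)%R P
     /\ eta pi (alpha_gen alpha) P = eta pi (alpha_gen (1 - alpha)%R) P)
  /\
  (* equivalence *)
  (forall a b : R, (0 < a)%R -> (a < b)%R -> (b < 1)%R ->
     ((a / b) * ((1 - b) / (1 - a)))%R%:E * etaR pi b P <= etaR pi a P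
     /\ etaR pi a P <= ((b / a) * ((1 - a) / (1 - b)))%R%:E * etaR pi b P)
  /\
  (* scrambling *)
  (forall beta : R, (1 < beta)%R ->
     ((scrambling P -> eta pi f P < 1)
      /\ (~ trivial_generator f -> eta pi f P < 1 -> scrambling P))
     /\ (scrambling P <-> eta pi (alpha_gen alpha) P < 1)
     /\ (scrambling P <-> etat (alpha_gen alpha) P < 1)
     /\ ((etaR pi beta P < 1 -> scrambling P)
         /\ (scrambling P -> common_support P -> etaR pi beta P < 1))
     /\ ((etatR beta P < 1 -> scrambling P)
         /\ (scrambling P -> common_support P -> etatR beta P < 1)))
  /\
  (* unit rank and independence *)
  (strictly_convex_at1 f -> forall beta : R, (1 < beta)%R ->
     [/\ \rank P = 1%N <-> eta pi f P = 0,
         \rank P = 1%N <-> eta pi (alpha_gen alpha) P = 0,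
         \rank P = 1%N <-> etaR pi beta P = 0,
         \rank P = 1%N <-> etat (alpha_gen alpha) P = 0
       & \rank P = 1%N <-> etatR beta P = 0]).
Proof.
have an1 : alpha != 1%R by exact/eqP.
have gen (a : R) : (0 < a)%R -> a <> 1%R ->
    convex_on_nonneg (alpha_gen a) /\ alpha_gen a 1 = 0%R.
  by move=> a0 a1; split; [exact: alpha_gen_convex|exact: alpha_gen1].
have [ca fa1] := gen _ halpha0 halpha1.
have strict (a : R) : (0 < a)%R -> a <> 1%R -> strictly_convex_at1 (alpha_gen a).
  exact: alpha_gen_strictly_convex_at1.
have ntriv (a : R) : (0 < a)%R -> a <> 1%R -> ~ trivial_generator (alpha_gen a).
  move=> a0 a1; apply: strictly_convex_at1_nontrivial; first exact: alpha_gen1.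
  exact: strict.
have hcf (g : R -> R) (Q : 'M[R]_n) : convex_on_nonneg g -> g 1%R = 0%R ->
    is_transition Q ->
    contracting (@is_transition R n) (fdiv pi g) (fun M => (M *m Q)%R).
  by move=> cg g1 hQ; exact: (fdiv_contracting hpi0).
have hct (g : R -> R) : convex_on_nonneg g -> g 1%R = 0%R ->
    contracting (@is_pmf R n) (@fdivt R n g) (fun mu => (mu *m P)%R).
  by move=> cg g1; exact: fdivt_contracting.
have ht := hct _ ca fa1.
have hfa := hcf _ _ ca fa1 hP.
have hR := renyi_contracting an1 hfa.
have hRt := renyi_contracting an1 ht.
have ee (g : R -> R) : convex_on_nonneg g -> g 1%R = 0%R -> eta pi g P = etat g P.
  by move=> cg g1; exact: (eta_etat hpi hpi0).
have etaDR (b : R) : (1 < b)%R -> eta pi (alpha_gen b) P <= etaR pi b P.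
  move=> b1; have b0 : (0 < b)%R by exact: lt_trans b1.
  have bn1 : b <> 1%R by apply/eqP; rewrite gt_eqF.
  have [cb fb1] := gen _ b0 bn1.
  by apply: ergodicity_coeff_le_renyi b1; [exact/eqP|exact: hcf].
have etatDR (b : R) : (1 < b)%R -> etat (alpha_gen b) P <= etatR b P.
  move=> b1; have b0 : (0 < b)%R by exact: lt_trans b1.
  have bn1 : b <> 1%R by apply/eqP; rewrite gt_eqF.
  have [cb fb1] := gen _ b0 bn1.
  by apply: ergodicity_coeff_le_renyi b1; [exact/eqP|exact: hct].
have scr (g : R -> R) : convex_on_nonneg g -> g 1%R = 0%R ->
    scrambling P -> etat g P < 1 by move=> cg g1; exact: scrambling_etat_lt1.
have scr' (g : R -> R) : convex_on_nonneg g -> g 1%R = 0%R -> ~ trivial_generator g ->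
    etat g P < 1 -> scrambling P by move=> cg g1; exact: etat_lt1_scrambling.
split.
  split.
    split; first exact: ergodicity_coeff_ge0.
      by rewrite !ee//; [exact: etat_le_tv|exact: tv_gen_convex|exact: tv_gen1].
    apply: ergodicity_coeff_le1; apply: hcf => //; first exact: tv_gen_convex.
    exact: tv_gen1.
  split; split; rewrite ?ergodicity_coeff_ge0//; exact: ergodicity_coeff_le1.
split; first by split; [exact: ee|exact: (etatR_le_etaR hpi hpi0)].
split.
  split=> [a1|a1|b b0 b1].
  - split; first exact: etaDR.
    move=> U V Us Vs hU hV hlim hUs hVs hD.
    have tUs := transition_limit hU hUs.
    have tVs := transition_limit hV hVs.
    split=> [UV|UV].
      apply: (renyi_coeff_le_log_ratio an1 hfa a1 hU hV hlim hD).
      by apply: fdiv_gt0 => //; exact: strict.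
    split; last by apply: ergodicity_coeff_le1.
    apply: (renyi_coeff_le_at_diag an1 hfa a1 hU hV hlim hD).
    by rewrite UV fdivxx.
  - split; first exact: etatDR.
    move=> mu nu mus nus hmu hnu hlim hmus hnus hD.
    have tmus := pmf_limit hmu hmus.
    have tnus := pmf_limit hnu hnus.
    split=> [munu|munu].
      apply: (renyi_coeff_le_log_ratio an1 ht a1 hmu hnu hlim hD).
      by apply: fdivt_gt0 => //; exact: strict.
    split; last by apply: ergodicity_coeff_le1.
    apply: (renyi_coeff_le_at_diag an1 ht a1 hmu hnu hlim hD).
    by rewrite munu fdivtxx.
  - have bn1 : b <> 1%R by apply/eqP; rewrite lt_eqF.
    have [cb fb1] := gen _ b0 bn1.
    by split; apply: renyi_le_ergodicity_coeff b1 => //;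
      [exact/eqP|exact: hcf|exact/eqP|exact: hct].
split.
  move=> P1 P2 t h1 h2 t0 t1; split; last by move=> a1; exact: etaR_convex.
  apply: ergodicity_coeff_convex => //; try exact: hcf.
    by apply: hcf => //; exact: transition_conv.
  by move=> M L d1 d2 hM hL D1 D2; exact: (fdiv_convex hpi0).
split.
  move=> Q hQ.
  have -> : eta pi f (P *m Q) = ergodicity_coeff (@is_transition R n) (fdiv pi f)
      ((fun M => M *m Q)%R \o (fun M => M *m P)%R).
    by congr ergodicity_coeff; apply/funext => M /=; rewrite mulmxA.
  apply: ergodicity_coeff_comp; try exact: hcf.
    by move=> M hM; exact: transition_mulmx.
  have := hcf f _ hf hf1 (transition_mulmx hP hQ).
  by congr contracting; apply/funext => M /=; rewrite mulmxA.
split.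
  move=> a1; have a10 : (0 < 1 - alpha)%R by rewrite subr_gt0.
  have a11 : (1 - alpha < 1)%R by rewrite gtrBl.
  have aK : (1 - (1 - alpha) = alpha)%R by rewrite opprB addrC subrK.
  split; apply/eqP; rewrite eq_le; apply/andP; split.
  - exact: etaR_symmetric_le.
  - by rewrite -[X in _ <= etaR _ X _]aK etaR_symmetric_le.
  - exact: eta_alpha_symmetric_le.
  - by rewrite -[X in _ <= eta _ (alpha_gen X) _]aK eta_alpha_symmetric_le.
split; first by move=> a b a0 ab b1; exact: etaR_equivalence.
split.
  move=> b b1; have b0 : (0 < b)%R by exact: lt_trans b1.
  have bn1 : b <> 1%R by apply/eqP; rewrite gt_eqF.
  have [cb fb1] := gen _ b0 bn1.
  have hscr : scrambling P <-> etat (alpha_gen alpha) P < 1.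
    by split; [exact: scr|apply: scr' => //; exact: ntriv].
  have RRt := etatR_le_etaR hpi hpi0 b P.
  (* For an order above 1 the Renyi coefficient dominates that of D_b, to which the scrambling
     criterion applies. *)
  have Rt1 : etatR b P < 1 -> scrambling P.
    move=> h; apply: (scr' _ cb fb1 (ntriv _ b0 bn1)).
    exact: le_lt_trans (etatDR _ b1) h.
  split; first by rewrite ee//; split; [exact: scr|exact: scr'].
  split; first by rewrite ee.
  split=> //.
  split; split=> //.
  - by move=> h; apply: Rt1; exact: le_lt_trans RRt h.
  - exact: (renyi_scrambling_lt1 hpi hpi0).
  - by move=> h1 h2; apply: le_lt_trans RRt _; exact: (renyi_scrambling_lt1 hpi hpi0).
move=> sf b b1; have b0 : (0 < b)%R by exact: lt_trans b1.
have bn1 : b <> 1%R by apply/eqP; rewrite gt_eqF.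
have [cb fb1] := gen _ b0 bn1.
have zero (g : R -> R) : convex_on_nonneg g -> g 1%R = 0%R ->
    strictly_convex_at1 g -> \rank P = 1%N <-> etat g P = 0.
  move=> cg g1 sg; split=> [/(rank1_rows hpi hP) h|h].
    apply: ergodicity_coeff_const => [mu nu hmu hnu|mu]; last exact: fdivtxx.
    exact: (equal_rows_mulmx hpi).
  by apply/(rank1_rows hpi hP); exact: (etat_eq0_rows cg g1 sg hP h).
(* Used to pass from a vanishing Renyi coefficient to the smaller D_b coefficient, whose vanishing
   characterizes unit rank. *)
have zeroR (e d : \bar R) : 0 <= d -> d <= e -> e = 0 -> d = 0.
  by move=> d0 de e0; apply/eqP; rewrite eq_le d0 -e0 de.
split; rewrite ?ee//; try exact: zero.
- by apply: zero => //; exact: strict.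
- split=> [/(rank1_rows hpi hP) h|h].
    apply: ergodicity_coeff_const => [M L hM hL|M].
      by apply/row_matrixP => x; rewrite !row_mul; exact: (equal_rows_mulmx hpi).
    by rewrite /renyi fdivxx// renyi_of0.
  apply/(zero _ cb fb1 (strict _ b0 bn1)); rewrite -ee//.
  by apply: zeroR (etaDR _ b1) h; exact: ergodicity_coeff_ge0.
- by apply: zero => //; exact: strict.
- split=> [/(rank1_rows hpi hP) h|h].
    apply: ergodicity_coeff_const => [mu nu hmu hnu|mu].
      exact: (equal_rows_mulmx hpi).
    by rewrite /renyit fdivtxx// renyi_of0.
  apply/(zero _ cb fb1 (strict _ b0 bn1)).
  by apply: zeroR (etatDR _ b1) h; exact: ergodicity_coeff_ge0.
Qed.
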